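(* Let $\nu,\hat\nu,\mu>0$, $N\in\mathbb{N}$, $f\in H$. Let $u_*\in D(A)$ satisfy $\nu Au_*+B(u_*,u_* )=f$, let $v_*\in D(A)$, $v_*\ne0$, satisfy $\hat\nu Av_*+B(v_*,v_* )+\mu P_Nv_*=f+\mu P_Nu_*$, and let $\hat v_*$ satisfy $\hat\nu A\hat v_*+\mu P_N\hat v_*+DB(v_* )\hat v_*=-Av_*$. Suppose $$\mu\ge\max\left\{\frac{32c_L^2\|v_*\|^2}{\hat\nu},\ \frac{16c_{BG}^2\|v_*\|^2}{\hat\nu}\left[1+\log\left(\frac{|Av_*|}{|v_*|}\right)\right]\right\},$$ $$N\ge\max\left\{\frac{8c_L\|v_*\|}{\hat\nu},\ \frac{4c_{BG}\|v_*\|}{\hat\nu}\left[1+\log\left(\frac{|Av_*|}{|v_*|}\right)\right]^{1/2}\right\}.$$ Then, with $\mathsf{P}_*(\hat\nu):=-(Av_*,\hat v_* )$, $$\mathsf{P}_*(\hat\nu)\ge\frac13\sup_{m\le N}\frac{|AP_mv_*|^2}{\hat\nu m^2+\mu}.$$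
   Context: Setting: $\mathbb{T}^2=[0,2\pi]^2$ with periodic boundary conditions. $H$ is the space of mean-free, divergence-free vector fields in $L^2(\mathbb{T}^2)$ with inner product $(\cdot,\cdot)$ and norm $|\cdot|$; $V=H^1\cap H$ with norm $\|u\|=|\nabla u|$; $P_\sigma$ is the Leray projection, $A=P_\sigma(-\Delta)=-\Delta$ with domain $D(A)=H^2\cap V$; $B(u,v)=P_\sigma((u\cdot\nabla)v)$; $DB(v)\phi=B(v,\phi)+B(\phi,v)$. For $m>0$, $P_m$ is the $L^2$-orthogonal projection onto Fourier wavenumbers $|k|\le m$. $c_L$ is the constant in Ladyzhenskaya's inequality $|\phi|_{L^4}^2\le c_L\|\phi\||\phi|$ and $c_{BG}$ the constant in the Brézis–Gallouet inequality $|\phi|_{L^\infty}\le c_{BG}\|\phi\|\left[1+\log(|A\phi|/\|\phi\|)\right]^{1/2}$ for $\phi\in D(A)$. *)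

(* Defs.v *)
From HB Require Import structures.
From mathcomp Require Import all_boot all_order all_algebra.
From mathcomp Require Import all_classical all_reals all_analysis.

Set Implicit Arguments.
Unset Strict Implicit.
Unset Printing Implicit Defensive.

Import Order.TTheory GRing.Theory Num.Theory.
Import numFieldNormedType.Exports.

Local Open Scope classical_set_scope.
Local Open Scope ring_scope.

Section Torus.
Context (R : realType).

Local Notation mR := (measurableTypeR R).

Lemma measurable_period : measurable (`[0%R, (2 * pi)%R]%classic : set mR).
Proof. exact: measurable_itv. Qed.

Lemma period_lty :
  (@lebesgue_measure R `[0%R, (2 * pi)%R]%classic < +oo)%E.
Proof. by rewrite lebesgue_measure_itv; case: ifP => _; rewrite ?ltry. Qed.

Definition circle : {finite_measure set mR -> \bar R} :=
  mfrestr measurable_period period_lty.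

(* A function on [0, 2 pi]^2 is represented by a function on the whole plane,
   whose values outside the square are invisible to [torus]. *)
Definition torus : {measure set (mR * mR) -> \bar R} :=
  (circle \x circle)%E.

Definition vfield : Type := 'I_2 -> R * R -> R.

Definition dir (j : 'I_2) : R * R := if j == ord0 then (1, 0) else (0, 1).

Definition partial (j : 'I_2) (phi : R * R -> R) : R * R -> R :=
  fun x => 'D_(dir j) phi x.

Definition smooth (phi : R * R -> R) : Prop :=
  forall s : seq 'I_2, let psi := foldr partial phi s in
    continuous psi /\ forall j x, derivable psi x (dir j).

Definition periodic (phi : R * R -> R) : Prop :=
  forall j x, phi (x + (2 * pi) *: dir j) = phi x.

Definition L2 (g : R * R -> R) : Prop := g \in Lfun torus 2%:E.

(* Testing against periodic functions, instead of compactly supported ones,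
   encodes the periodic boundary conditions. *)
Definition is_wderiv (j : 'I_2) (g h : R * R -> R) : Prop :=
  L2 h /\ forall phi, smooth phi -> periodic phi ->
    \int[torus]_x (g x * partial j phi x) = - \int[torus]_x (h x * phi x).

(* The weak derivative is unique up to equality almost everywhere on the
   square; [wderiv] selects one representative when it exists. *)
Definition wderiv (j : 'I_2) (g : R * R -> R) : R * R -> R :=
  get [set h | is_wderiv j g h].

Definition H1 (g : R * R -> R) : Prop :=
  L2 g /\ forall j, exists h, is_wderiv j g h.

Definition H2 (g : R * R -> R) : Prop :=
  H1 g /\ forall j, H1 (wderiv j g).

Definition veq (u v : vfield) : Prop := forall i, u i = v i %[ae torus].

Definition vL2 (u : vfield) : Prop := forall i, L2 (u i).

Definition vdot (u v : vfield) : R :=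
  \sum_i \int[torus]_x (u i x * v i x).

Definition norm2 (u : vfield) : R := Num.sqrt (vdot u u).

Definition normV (u : vfield) : R :=
  Num.sqrt (\sum_i \sum_j \int[torus]_x (wderiv j (u i) x) ^+ 2).

Definition vabs (u : vfield) : R * R -> R :=
  fun x => Num.sqrt (\sum_i u i x ^+ 2).

Definition normLp (p : \bar R) (u : vfield) : \bar R :=
  'N[torus]_p[EFin \o vabs u].

Definition mean_free (u : vfield) : Prop :=
  forall i, \int[torus]_x u i x = 0.

Definition div_free (u : vfield) : Prop :=
  forall phi, smooth phi -> periodic phi ->
    \sum_i \int[torus]_x (u i x * partial i phi x) = 0.

Definition spaceH : set vfield :=
  [set u | [/\ vL2 u, mean_free u & div_free u]].

Definition spaceV : set vfield :=
  [set u | spaceH u /\ forall i, H1 (u i)].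

Definition domA : set vfield :=
  [set u | spaceV u /\ forall i, H2 (u i)].

Definition opA (u : vfield) : vfield :=
  fun i x => - \sum_j wderiv j (wderiv j (u i)) x.

(* graph of the Leray projection, the L2-orthogonal projection onto H *)
Definition is_leray (w h : vfield) : Prop :=
  [/\ vL2 w, spaceH h & forall phi, spaceH phi ->
      vdot (fun i x => w i x - h i x) phi = 0].

Definition advect (u v : vfield) : vfield :=
  fun i x => \sum_j u j x * wderiv j (v i) x.

Definition is_B (u v b : vfield) : Prop := is_leray (advect u v) b.

Definition is_DB (v phi b : vfield) : Prop :=
  exists b1 b2, [/\ is_B v phi b1, is_B phi v b2 &
    b = fun i x => b1 i x + b2 i x].

Definition wavenum_norm (k : int * int) : R :=
  Num.sqrt ((k.1 ^+ 2 + k.2 ^+ 2)%:~R).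

Definition phase (k : int * int) (x : R * R) : R :=
  k.1%:~R * x.1 + k.2%:~R * x.2.

(* The real and imaginary parts of the Fourier coefficient
   (2 pi)^-2 \int g(x) exp(- i k . x) dx are [fcos g k] and [- fsin g k]. *)
Definition fcos (g : R * R -> R) (k : int * int) : R :=
  ((2 * pi) ^+ 2)^-1 * \int[torus]_x (g x * cos (phase k x)).

Definition fsin (g : R * R -> R) (k : int * int) : R :=
  ((2 * pi) ^+ 2)^-1 * \int[torus]_x (g x * sin (phase k x)).

(* The L2-orthogonal projection onto the wavenumbers |k| <= m: the summand is
   Re(ghat_k exp(i k . x)), and for real g the imaginary parts of the terms of
   index k and - k cancel. *)
Definition fproj (m : R) (g : R * R -> R) : R * R -> R := fun x =>
  \sum_(k \in [set k : int * int | wavenum_norm k <= m])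
    (fcos g k * cos (phase k x) + fsin g k * sin (phase k x)).

Definition opP (m : R) (u : vfield) : vfield := fun i => fproj m (u i).

Definition ladyzhenskaya (cL : R) : Prop :=
  forall phi, spaceV phi ->
    (normLp 4%:E phi ^+ 2 <= (cL * normV phi * norm2 phi)%:E)%E.

Definition brezis_gallouet (cBG : R) : Prop :=
  forall phi, domA phi ->
    (normLp +oo%E phi <=
      (cBG * normV phi *
        Num.sqrt (1 + ln (norm2 (opA phi) / normV phi)))%:E)%E.

End Torus.

(* Main.v *)
(** Write w for the sensitivity, P = - (A v, w), and phi = A P_m v. Testing the
    equation for w with w kills B(v, w) and leaves
      P = nuh ||w||^2 + mu |P_N w|^2 + (B(w, v), w);
    testing it with the divergence-free trigonometric polynomial phi bounds
    |phi|^2 by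
      |phi| (nuh m ||w|| + mu |P_N w| + |v|_oo ||w|| + |v|_oo m |w|).
    With |w| <= |P_N w| + ||w|| / N, the hypotheses on mu and N make the
    convective terms small fractions of the quadratic form
    nuh ||w||^2 + mu |P_N w|^2, and Cauchy-Schwarz closes the estimate.

    The only deep input is the completeness of the trigonometric system on the
    torus. The polynomials (1 - s^n)^(2^n), composed with a trigonometric
    polynomial that has the sign of x_i - a on the period, approximate the
    indicators of quadrants; a Dynkin argument then reaches all measurable sets,
    and simple functions all of L^2. *)
Require Import Defs.
From HB Require Import structures.
From mathcomp Require Import all_boot all_order all_algebra.
From mathcomp Require Import all_classical all_reals all_analysis.
From mathcomp Require Import measurable_realfun ess_sup_inf.
From mathcomp Require Import measurable_fun_approximation simple_functions.
From mathcomp Require Import ring lra zify.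
Import Order.TTheory GRing.Theory Num.Theory.
Import numFieldNormedType.Exports.
Local Open Scope classical_set_scope.
Local Open Scope ring_scope.

Set Implicit Arguments.
Unset Strict Implicit.
Unset Printing Implicit Defensive.

(** * Square-integrable functions *)

Section SquareIntegrable.
Context d (T : measurableType d) (R : realType).
Variable mu : {measure set T -> \bar R}.
Implicit Types f g h F G H : T -> R.

(** Weak derivatives are given here only by testing against smooth periodic functions, and [wderiv]
    picks a representative. Completeness is what makes them usable: convergence of [fproj] in L2
    yields their uniqueness almost everywhere, integration by parts between two weakly
    differentiable functions, the vanishing of (B(v, w), w), and the Poincaré inequalities above a
    cutoff. The Brézis-Gallouet bound on |v|_oo contains log(|Av| / ||v||), the hypotheses log(|Av|
    / |v|); Poincaré's |v| <= ||v|| links the two. No gradient of v may appear when testing with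
    phi, so in (B(w, v), phi) the derivative is moved onto phi. Constants: with Q = nuh ||w||^2 + mu
    |P_N w|^2, the factors 16 and 4 make |v|_oo at most a quarter of sqrt(mu nuh) and of nuh N,
    which gives |phi|^2 <= 2 (nuh m^2 + mu) Q. The factors 32 and 8 let (B(w, v), w) consume less
    than a third of Q, so P >= 2/3 Q. The quotient of 2 by 2/3 is the 3 of the claim. *)

Definition itg f := mu.-integrable setT (EFin \o f).

Lemma itg_measurable f : itg f -> measurable_fun setT f.
Proof. by move=> /measurable_int/measurable_EFinP. Qed.

Lemma itgD f g : itg f -> itg g -> itg (fun x => f x + g x).
Proof. by move=> fi gi; have := integrableD measurableT fi gi. Qed.

Lemma itgZ a f : itg f -> itg (fun x => a * f x).
Proof. by move=> fi; have := integrableZl measurableT a fi. Qed.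

Lemma itgN f : itg f -> itg (fun x => - f x).
Proof. by move=> fi; have := integrableN fi. Qed.

Lemma itg_norm f : itg f -> itg (fun x => `|f x|).
Proof. by move=> fi; have := integrable_abse fi. Qed.

Lemma itg0 : itg (fun _ => 0).
Proof. exact: integrable0. Qed.

Lemma itg_cst (c : R) : (mu setT < +oo)%E -> itg (fun=> c).
Proof.
move=> muT; apply/integrableP; split; first exact/measurable_EFinP.
rewrite [X in (X < _)%E](_ : _ = `|c|%:E * mu setT)%E; last exact: integral_cst.
by rewrite lte_mul_pinfty.
Qed.

Lemma itg_sum (I : Type) (r : seq I) (P : pred I) (F : I -> T -> R) :
  (forall i, itg (F i)) -> itg (fun x => \sum_(i <- r | P i) F i x).
Proof.
move=> Fi; elim: r => [|i r IH].
  by under [X in itg X]eq_fun do rewrite big_nil; exact: itg0.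
under [X in itg X]eq_fun do rewrite big_cons.
by case: (P i) => //; exact: itgD.
Qed.

Lemma RintZ a f : itg f -> \int[mu]_x (a * f x) = a * \int[mu]_x f x.
Proof. by move=> fi; rewrite RintegralZl. Qed.

Lemma RintD f g : itg f -> itg g ->
  \int[mu]_x (f x + g x) = \int[mu]_x f x + \int[mu]_x g x.
Proof. by move=> fi gi; rewrite RintegralD. Qed.

Lemma RintB f g : itg f -> itg g ->
  \int[mu]_x (f x - g x) = \int[mu]_x f x - \int[mu]_x g x.
Proof. by move=> fi gi; rewrite RintegralB. Qed.

Lemma RintN f : itg f -> \int[mu]_x (- f x) = - \int[mu]_x f x.
Proof.
by move=> fi; rewrite -mulN1r -RintZ//; under [RHS]eq_Rintegral do rewrite mulN1r.
Qed.

Lemma Rint_sum (I : Type) (r : seq I) (P : pred I) (F : I -> T -> R) :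
  (forall i, itg (F i)) ->
  \int[mu]_x (\sum_(i <- r | P i) F i x) =
  \sum_(i <- r | P i) \int[mu]_x F i x.
Proof.
move=> Fi; elim: r => [|i r IH].
  rewrite big_nil; under eq_Rintegral do rewrite big_nil.
  by rewrite Rintegral_cst// mul0r.
under eq_Rintegral do rewrite big_cons.
rewrite big_cons; case: (P i) => //.
by rewrite RintD ?IH//; exact: itg_sum.
Qed.

Lemma Rint_ae f g : measurable_fun setT f -> measurable_fun setT g ->
  (\forall x \ae mu, f x = g x) -> \int[mu]_x f x = \int[mu]_x g x.
Proof.
move=> mf mg fg; congr fine; apply: ae_eq_integral => //.
- exact/measurable_EFinP.
- exact/measurable_EFinP.
- by apply: filterS fg => x /= ->.
Qed.

Lemma le_itg f g : measurable_fun setT f -> itg g ->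
  (\forall x \ae mu, `|f x| <= g x) -> itg f.
Proof.
move=> mf gi fg; apply/integrableP; split; first exact/measurable_EFinP.
have gm := itg_measurable gi.
move/integrableP: gi => [_]; apply: le_lt_trans.
apply: ae_ge0_le_integral => //.
- by apply: measurableT_comp => //; exact/measurable_EFinP.
- by apply: measurableT_comp => //; exact/measurable_EFinP.
- by apply: filterS fg => x /= fgx _; rewrite lee_fin (le_trans fgx)// ler_norm.
Qed.

Lemma le_Rint f g : itg f -> itg g -> (\forall x \ae mu, f x <= g x) ->
  \int[mu]_x f x <= \int[mu]_x g x.
Proof.
move=> fi gi fg; have fm := itg_measurable fi; have gm := itg_measurable gi.
(* The minimum equals f almost everywhere and lies below g everywhere, which reduces the claim to
   pointwise monotonicity. *)
have mi : itg (fun x => Num.min (f x) (g x)).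
  apply: (@le_itg _ (fun x => `|f x| + `|g x|)).
  - exact: measurable_minr.
  - by apply: itgD; exact: itg_norm.
  - apply: nearW => x; rewrite /Num.min; case: ifP => _.
      by rewrite lerDl.
    by rewrite lerDr.
have -> : \int[mu]_x f x = \int[mu]_x Num.min (f x) (g x).
  apply: Rint_ae => //; first exact: measurable_minr.
  by apply: filterS fg => x fgx; rewrite min_l.
by apply: le_Rintegral => // x _; rewrite ge_min lexx orbT.
Qed.

Lemma sqrt_Young (x a b : R) : 0 <= a -> 0 <= b ->
  (forall t, 0 < t -> 2 * x <= t * a + t^-1 * b) ->
  x <= Num.sqrt a * Num.sqrt b.
Proof.
move=> a0 b0 h; apply/ler_addgt0Pr => e e0.
set p := Num.sqrt a; set q := Num.sqrt b.
have p0 : 0 <= p := sqrtr_ge0 a; have q0 : 0 <= q := sqrtr_ge0 b.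
have ap : a = p ^+ 2 by rewrite sqr_sqrtr.
have bq : b = q ^+ 2 by rewrite sqr_sqrtr.
(* The shift costs r (p + q) / 2, which this choice keeps below e. *)
pose r : R := e / (p + q + 1 + e).
have s0 : 0 < p + q + 1 + e by lra.
have r0 : 0 < r by rewrite divr_gt0.
have rE : r * (p + q + 1 + e) = e by rewrite divfK// gt_eqF.
have r1 : r <= 1 by rewrite ler_pdivrMr// mul1r; lra.
have pr0 : 0 < p + r by lra.
have qr0 : 0 < q + r by lra.
have := h ((q + r) / (p + r)) (divr_gt0 qr0 pr0).
rewrite invf_div ap bq.
have H1 : (q + r) / (p + r) * p ^+ 2 <= (q + r) * p.
  rewrite mulrAC ler_pdivrMr// -mulrA ler_wpM2l ?(ltW qr0)// expr2 ler_wpM2l//; lra.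
have H2 : (p + r) / (q + r) * q ^+ 2 <= (p + r) * q.
  rewrite mulrAC ler_pdivrMr// -mulrA ler_wpM2l ?(ltW pr0)// expr2 ler_wpM2l//; lra.
nra.
Qed.

(* Young's inequality [2 |F| <= t G + H / t] for every [t > 0]. *)
Lemma Rint_CauchySchwarz F G H : measurable_fun setT F -> itg G -> itg H ->
  (\forall x \ae mu, [/\ 0 <= G x, 0 <= H x & F x ^+ 2 <= G x * H x]) ->
  itg F /\
  `|\int[mu]_x F x| <= Num.sqrt (\int[mu]_x G x) * Num.sqrt (\int[mu]_x H x).
Proof.
move=> mF Gi Hi FGH.
have key t : 0 < t -> \forall x \ae mu, 2 * `|F x| <= t * G x + t^-1 * H x.
  move=> t0; apply: filterS FGH => x [G0 H0 FGHx].
  have tt : t * t^-1 = 1 by rewrite divff// gt_eqF.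
  have ti0 : 0 < t^-1 by rewrite invr_gt0.
  have s0 : 0 <= t * G x + t^-1 * H x by apply: addr_ge0; apply: mulr_ge0 => //; exact: ltW.
  rewrite -(ler_pXn2r (n := 2)) ?nnegrE ?mulr_ge0//.
  rewrite exprMn real_normK ?num_real//.
  have -> : (t * G x + t^-1 * H x) ^+ 2 =
    (t * G x - t^-1 * H x) ^+ 2 + 4 * (t * t^-1) * (G x * H x) by ring.
  rewrite tt; have := sqr_ge0 (t * G x - t^-1 * H x); lra.
have Fi : itg F.
  apply: (@le_itg _ (fun x => G x + H x)) => //; first exact: itgD.
  apply: filterS (key 1 ltr01) => x; rewrite invr1 !mul1r.
  have := normr_ge0 (F x); lra.
split => //.
have aF : itg (fun x => `|F x|) by exact: itg_norm.
apply: le_trans (le_normr_Rintegral measurableT Fi) _.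
have nn (K : T -> R) : itg K -> (\forall x \ae mu, 0 <= K x) -> 0 <= \int[mu]_x K x.
  move=> Ki K0; have := le_Rint itg0 Ki K0; by rewrite Rintegral_cst// mul0r.
apply: sqrt_Young.
- by apply: nn => //; apply: filterS FGH => x [].
- by apply: nn => //; apply: filterS FGH => x [].
move=> t t0; rewrite -!RintZ// -RintD; [|exact: itgZ|exact: itgZ].
apply: le_Rint; [exact: itgZ|by apply: itgD; exact: itgZ|exact: key].
Qed.

Local Notation L2 f := (f \in Lfun mu 2%:E).

Lemma L2_measurable f : L2 f -> measurable_fun setT f.
Proof. by rewrite inE => /andP[+ _]; rewrite inE. Qed.

Lemma L2P f : L2 f <-> measurable_fun setT f /\ itg (fun x => f x ^+ 2).
Proof.
split=> [lf|[mf fi]].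
  by split; [exact: L2_measurable | exact: Lfun2_integrable_sqr].
rewrite inE; apply/andP; split; rewrite inE//=.
rewrite /finite_norm unlock poweR_lty//.
move/integrableP: fi => [_]; apply: le_lt_trans.
rewrite le_eqVlt; apply/orP; left; apply/eqP.
apply: eq_integral => x _ /=.
by rewrite powR_mulrn// normrX.
Qed.

Lemma L2M f g : L2 f -> L2 g -> itg (fun x => f x * g x).
Proof. by move=> lf lg; apply/Lfun1_integrable; exact: Lfun2_mul_Lfun1. Qed.

Lemma L2D f g : L2 f -> L2 g -> L2 (fun x => f x + g x).
Proof.
move=> lf lg; have mf := L2_measurable lf; have mg := L2_measurable lg.
apply/L2P; split; first exact: measurable_funD.
apply: (@le_itg _ (fun x => 2 * f x ^+ 2 + 2 * g x ^+ 2)).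
- by apply: measurable_funX; exact: measurable_funD.
- by apply: itgD; apply: itgZ; [case/L2P: lf | case/L2P: lg].
- apply: nearW => x; rewrite ger0_norm ?sqr_ge0//.
  by have := sqr_ge0 (f x - g x); lra.
Qed.

Lemma L2Z a f : L2 f -> L2 (fun x => a * f x).
Proof.
move=> lf; have mf := L2_measurable lf; apply/L2P; split.
  by apply: measurable_funM.
under [X in itg X]eq_fun do rewrite exprMn.
by apply: itgZ; case/L2P: lf.
Qed.

Lemma L2N f : L2 f -> L2 (fun x => - f x).
Proof.
by move=> /(L2Z (-1)); under [X in L2 X -> _]eq_fun do rewrite mulN1r.
Qed.

Lemma L2B f g : L2 f -> L2 g -> L2 (fun x => f x - g x).
Proof. by move=> lf lg; apply: L2D => //; exact: L2N. Qed.

Lemma L2_0 : L2 (fun _ : T => 0 : R).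
Proof.
apply/L2P; split => //.
by under [X in itg X]eq_fun do rewrite expr0n; exact: itg0.
Qed.

Lemma L2_sum (I : Type) (r : seq I) (P : pred I) (F : I -> T -> R) :
  (forall i, L2 (F i)) -> L2 (fun x => \sum_(i <- r | P i) F i x).
Proof.
move=> Fi; elim: r => [|i r IH].
  by under [X in L2 X]eq_fun do rewrite big_nil; exact: L2_0.
under [X in L2 X]eq_fun do rewrite big_cons.
by case: (P i) => //; exact: L2D.
Qed.

Lemma L2_mul_bounded M f g : measurable_fun setT f -> L2 g ->
  (\forall x \ae mu, `|f x| <= M) -> L2 (fun x => f x * g x).
Proof.
move=> mf lg fM; have mg := L2_measurable lg.
apply/L2P; split; first exact: measurable_funM.
apply: (@le_itg _ (fun x => M ^+ 2 * g x ^+ 2)).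
- by apply: measurable_funX; exact: measurable_funM.
- by apply: itgZ; case/L2P: lg.
- apply: filterS fM => x fM; rewrite ger0_norm ?sqr_ge0// exprMn ler_wpM2r ?sqr_ge0//.
  by rewrite -[f x ^+ 2]real_normK ?num_real// lerXn2r ?nnegrE// (le_trans _ fM).
Qed.

Lemma L2_bounded M f : (mu setT < +oo)%E -> measurable_fun setT f ->
  (\forall x \ae mu, `|f x| <= M) -> L2 f.
Proof.
move=> muT mf fM; apply/L2P; split => //.
apply: (@le_itg _ (fun=> M ^+ 2)).
- exact: measurable_funX.
- exact: itg_cst.
- apply: filterS fM => x fM; rewrite ger0_norm ?sqr_ge0//.
  by rewrite -[f x ^+ 2]real_normK ?num_real// lerXn2r ?nnegrE// (le_trans _ fM).
Qed.

Lemma L2_CauchySchwarz f g : L2 f -> L2 g ->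
  `|\int[mu]_x (f x * g x)| <=
  Num.sqrt (\int[mu]_x f x ^+ 2) * Num.sqrt (\int[mu]_x g x ^+ 2).
Proof.
move=> lf lg; apply: (proj2 (@Rint_CauchySchwarz _ _ _ _ _ _ _)).
- by apply: measurable_funM; exact: L2_measurable.
- by case/L2P: lf.
- by case/L2P: lg.
- by apply: nearW => x; split; rewrite ?sqr_ge0// exprMn.
Qed.

Lemma Rint_sqr_ge0 f : 0 <= \int[mu]_x f x ^+ 2.
Proof. by apply: Rintegral_ge0 => x _; exact: sqr_ge0. Qed.

Lemma Rint_sqr_eq0 f : L2 f -> \int[mu]_x f x ^+ 2 = 0 ->
  \forall x \ae mu, f x = 0.
Proof.
case/L2P => mf fi f0.
have h : (\int[mu]_x `|(f x ^+ 2)%:E|)%E = 0%E.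
  transitivity (\int[mu]_x (f x ^+ 2)%:E)%E.
    by apply: eq_integral => x _; rewrite /= ger0_norm ?sqr_ge0.
  by rewrite -[LHS]fineK ?(integrable_fin_num measurableT fi)// [fine _]f0.
have := (ae_eq_integral_abs mu measurableT _).1 h.
move=> /(_ (measurable_int mu fi)); apply: filterS => x /(_ I) /= [] /eqP.
by rewrite sqrf_eq0 => /eqP.
Qed.

End SquareIntegrable.

(** * The measure on the torus *)

Section TorusMeasure.
Context (R : realType).
Local Notation mR := (measurableTypeR R).
Local Notation torus := (torus R).
Local Notation circle := (circle R).
Implicit Types (f g : R * R -> R).

Definition box (p : rat * rat * (rat * rat)) : set (R * R) :=
  `]ratr p.1.1, ratr p.1.2[%classic `*` `]ratr p.2.1, ratr p.2.2[%classic.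

(** The topology of the plane and the product sigma-algebra are linked by the rational boxes: they
    form a base and there are countably many of them. *)
Lemma open_measurable_prod (U : set (R * R)) : open U ->
  measurable (U : set (mR * mR)).
Proof.
move=> oU.
have -> : U = \bigcup_(p in [set p | box p `<=` U]) box p.
  apply/seteqP; split=> [x Ux|x [p /= pU px]]; last exact: pU.
  have /nbhs_ballP[e /= e0 eU] : nbhs x U by exact: open_nbhs_nbhs.
  have xl (a : R) : a - e < a by rewrite ltrBlDr ltrDl.
  have xr (a : R) : a < a + e by rewrite ltrDl.
  have [p1 p1P] := rat_in_itvoo (xl x.1); have [p2 p2P] := rat_in_itvoo (xr x.1).
  have [q1 q1P] := rat_in_itvoo (xl x.2); have [q2 q2P] := rat_in_itvoo (xr x.2).
  move: p1P p2P q1P q2P; rewrite !in_itv/= => /andP[? ?] /andP[? ?] /andP[? ?] /andP[? ?].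
  apply: (ex_intro2 _ _ (p1, p2, (q1, q2))); rewrite /box /=.
    move=> y [] /=; rewrite !in_itv/= => /andP[? ?] /andP[? ?]; apply: eU.
    by split; rewrite /ball/= ltr_norml; lra.
  by split; rewrite /= in_itv/=; apply/andP.
rewrite bigcup_mkcond; apply: countable_bigcupT_measurable => // p.
by case: ifP => // _; apply: measurableX; exact: measurable_itv.
Qed.

Lemma continuous_measurable_prod f : continuous f ->
  measurable_fun setT (f : mR * mR -> mR).
Proof.
move=> /continuousP cf; apply: (measurability _ (RGenOpens.measurableE R)).
move=> _ [_ [a [b ->] <-]]; rewrite setTI; apply: open_measurable_prod.
exact/cf/interval_open.
Qed.

Instance circle_ae_filter : Filter (nbhs (almost_everywhere circle)).
Proof. exact: ae_filter_ringOfSetsType. Qed.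

Instance torus_ae_filter : Filter (nbhs (almost_everywhere torus)).
Proof. exact: ae_filter_ringOfSetsType. Qed.

Lemma circleT : circle setT = (2 * pi)%:E.
Proof.
rewrite /circle/= /mfrestr /mrestr setTI lebesgue_measure_itv/= lte_fin.
by rewrite mulr_gt0 ?pi_gt0// sube0.
Qed.

Lemma circle_lty : (circle setT < +oo)%E.
Proof. by rewrite circleT ltry. Qed.

Lemma torusX (A B : set mR) : measurable A -> measurable B ->
  torus (A `*` B) = (circle A * circle B)%E.
Proof. by move=> mA mB; exact: product_measure1E. Qed.

Lemma torusT : torus setT = ((2 * pi) ^+ 2)%:E.
Proof. by rewrite -setXTT torusX// circleT -EFinM. Qed.

Lemma torus_lty : (torus setT < +oo)%E.
Proof. by rewrite torusT ltry. Qed.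

Lemma circle_null (A B : set mR) : measurable A -> measurable B ->
  lebesgue_measure B = 0%E -> A `&` `[0, 2 * pi]%classic `<=` B -> circle A = 0%E.
Proof.
move=> mA mB B0 AB; apply: (@subset_measure0 _ _ _ (@lebesgue_measure R) _ B) => //.
by apply: measurableI => //; exact: measurable_itv.
Qed.

Lemma circle_ae_itv : \forall t \ae circle, t \in `]0, 2 * pi[.
Proof.
exists (~` `]0, 2 * pi[%classic); split.
- by apply: measurableC; exact: measurable_itv.
- apply: (@circle_null _ ([set 0] `|` [set 2 * pi])).
  + by apply: measurableC; exact: measurable_itv.
  + by apply: measurableU; exact: measurable_set1.
  + by apply: null_set_setU; [exact: measurable_set1|exact: measurable_set1|
        exact: lebesgue_measure_set1|exact: lebesgue_measure_set1].
  + move=> t [/= nt]; rewrite in_itv/= => /andP[t0 t1].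
    move: t0 t1; rewrite !le_eqVlt => /orP[/eqP <-|t0]; first by left.
    move=> /orP[/eqP ->|t1]; first by right.
    by exfalso; apply: nt; rewrite in_itv/= t0.
- by move=> t /= nt; exact: nt.
Qed.

Lemma circle_ae_neq a : \forall t \ae circle, t != a.
Proof.
exists [set a]; split.
- exact: measurable_set1.
- apply: (@circle_null _ [set a]).
  + exact: measurable_set1.
  + exact: measurable_set1.
  + exact: lebesgue_measure_set1.
  + by move=> t [].
- by move=> t /= /negP; rewrite negbK => /eqP.
Qed.

Lemma torus_ae1 (P : R -> Prop) : (\forall t \ae circle, P t) ->
  \forall x \ae torus, P x.1.
Proof.
move=> [A [mA A0 PA]]; exists (A `*` setT); split.
- exact: measurableX.
- by rewrite torusX// [X in (X * _)%E]A0 mul0e.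
- by move=> x /= nx; split => //; exact: PA.
Qed.

Lemma torus_ae2 (P : R -> Prop) : (\forall t \ae circle, P t) ->
  \forall x \ae torus, P x.2.
Proof.
move=> [A [mA A0 PA]]; exists (setT `*` A); split.
- exact: measurableX.
- by rewrite torusX// [X in (_ * X)%E]A0 mule0.
- by move=> x /= nx; split => //; exact: PA.
Qed.

(** On the whole plane f may be unbounded; only the compact square carries mass, hence a bound
    almost everywhere. *)
Lemma continuous_ae_bounded f : continuous f ->
  exists M, \forall x \ae torus, `|f x| <= M.
Proof.
move=> cf.
have cK := compact_setX (@segment_compact R 0 (2 * pi)) (@segment_compact R 0 (2 * pi)).
have /(continuous_compact (continuous_subspaceT cf))/compact_bounded[M [_ HM]] := cK.
exists (M + 1); apply: filterS2 (torus_ae1 circle_ae_itv) (torus_ae2 circle_ae_itv).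
move=> x x1 x2; apply: (HM (M + 1)); first by rewrite ltrDl.
by exists x => //; split => /=; apply: subset_itv_oo_cc.
Qed.

Lemma continuous_L2 f : continuous f -> L2 f.
Proof.
move=> cf; have [M fM] := continuous_ae_bounded cf.
by apply: (L2_bounded torus_lty _ fM); exact: continuous_measurable_prod.
Qed.

Lemma L2_itg f : L2 f -> itg torus f.
Proof.
move=> fL; have oL : @L2 R (fun=> 1) by apply: continuous_L2 => x; exact: cvg_cst.
suff -> : f = (fun x => f x * 1) by exact: L2M.
by apply/funext => x; rewrite mulr1.
Qed.

(** This trades the restricted measure for a restricted domain, the form in which the fundamental
    theorem of calculus applies. *)
Lemma integral_circle (g : R -> R) : circle.-integrable setT (EFin \o g) ->
  (\int[circle]_t (g t)%:E = \int[lebesgue_measure]_(t in `[0%R, (2 * pi)%R]) (g t)%:E)%E.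
Proof.
move=> gi.
transitivity (\int[circle]_(t in setT `\` ~` `[0%R, (2 * pi)%R]%classic) (g t)%:E)%E.
  apply: (negligible_integral _ measurableT gi).
    by apply: measurableC; exact: measurable_itv.
  apply: (@circle_null _ set0) => //.
  - by apply: measurableC; exact: measurable_itv.
  - by rewrite setIC setICr.
rewrite setTD setCK; apply: eq_measure_integral => A mA Asub.
by rewrite /circle/= /mfrestr /mrestr; congr (lebesgue_measure _); apply/setIidl.
Qed.

Lemma is_derive_path f x v t :
  (forall s, derivable f (x + s *: v) v) ->
  is_derive t (1 : R) (fun s : R => f (x + s *: v)) ('D_v f (x + t *: v)).
Proof.
move=> df.
have E : (fun h : R => h^-1 *: (((fun s => f (x + s *: v)) \o shift t) (h *: 1) -
    f (x + t *: v))) =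
  (fun h : R => h^-1 *: ((f \o shift (x + t *: v)) (h *: v) - f (x + t *: v))).
  apply/funext => h; congr (_ *: (f _ - _)) => /=.
  have -> : h *: (1 : R) = h by exact: mulr1.
  by rewrite scalerDl addrCA.
by split; rewrite /derivable /derive E//; exact: df.
Qed.

Lemma continuous_line x v : continuous (fun s : R => (x : R * R) + s *: (v : R * R)).
Proof.
move=> t; have := @continuousD R _ _ (fun _ : R => x) (fun s : R => s *: v) t.
by apply; [exact: cst_continuous|exact: scalel_continuous].
Qed.

Lemma continuous_along_line f x v : continuous f ->
  continuous (fun t : R => f (x + t *: v)).
Proof.
move=> cf t.
exact: (@continuous_comp _ _ _ (fun s : R => x + s *: v) f t
  (@continuous_line x v t) (cf _)).
Qed.

Lemma FTC_path f x v a b : a < b ->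
  continuous (fun y => 'D_v f y) ->
  (forall y, derivable f y v) ->
  (\int[lebesgue_measure]_(t in `[a, b]) ('D_v f (x + t *: v))%:E =
   (f (x + b *: v))%:E - (f (x + a *: v))%:E)%E.
Proof.
move=> ab cf df.
have D t := @is_derive_path f x v t (fun s => df _).
have cg t : {for t, continuous (fun s : R => f (x + s *: v))}.
  by apply/differentiable_continuous/derivable1_diffP; case: (D t).
apply: (continuous_FTC2 (F := fun s => f (x + s *: v)) ab).
- by apply: continuous_subspaceT; exact: continuous_along_line cf.
- split.
  + by move=> t _; case: (D t).
  + by apply: cvg_at_right_filter; exact: cg.
  + by apply: cvg_at_left_filter; exact: cg.
- by move=> t _; rewrite derive1E; case: (D t).
Qed.

Lemma circle_periodic_derive f v y :
  continuous (fun y => 'D_v f y) -> (forall y, derivable f y v) ->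
  (forall y, f (y + (2 * pi) *: v) = f y) ->
  (\int[circle]_t ('D_v f (y + t *: v))%:E = 0)%E.
Proof.
move=> cf df pf.
have cD : continuous (fun t : R => 'D_v f (y + t *: v)) := continuous_along_line cf.
rewrite integral_circle.
  rewrite FTC_path// ?mulr_gt0 ?pi_gt0//.
  by rewrite pf scale0r addr0 subee.
have /compact_bounded[M [_ HM]] :=
  continuous_compact (continuous_subspaceT cD) (@segment_compact R 0 (2 * pi)).
apply: (@le_itg _ _ _ circle _ (fun=> M + 1)).
- exact: continuous_measurable_fun.
- by apply: itg_cst; exact: circle_lty.
- apply: filterS circle_ae_itv => t t1.
  apply: (HM (M + 1)); first by rewrite ltrDl.
  by exists t => //; apply: subset_itv_oo_cc.
Qed.

(** Fubini's theorem with the j-th variable innermost: the inner integral is that of a derivative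
    over a full period. *)
Lemma int_partial_eq0 j f : continuous (partial j f) ->
  (forall x, derivable f x (dir R j)) -> Defs.periodic f ->
  \int[torus]_x partial j f x = 0.
Proof.
move=> cf df pf; rewrite /Rintegral.
have fi : itg torus (partial j f) by apply/L2_itg/continuous_L2.
have pE (a b t : R) : (a, b) + t *: dir R j =
    if j == ord0 then (a + t, b) else (a, b + t).
  by rewrite /dir; case: ifP => _; congr pair;
    rewrite /= ?scaler0 ?addr0//; congr (_ + _); exact: mulr1.
have [j0|j1] := boolP (j == ord0).
  rewrite -(integral21_prod_meas1 fi) integral0_eq// => y _.
  rewrite /fubini_G/= -[RHS](@circle_periodic_derive f (dir R j) (0, y) cf df (pf j)).
  by apply: eq_integral => t _; rewrite pE j0 add0r.
rewrite -(integral12_prod_meas1 fi) integral0_eq// => y _.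
rewrite /fubini_F/= -[RHS](@circle_periodic_derive f (dir R j) (y, 0) cf df (pf j)).
by apply: eq_integral => t _; rewrite pE (negbTE j1) add0r.
Qed.

(* Unification with the generic lemmas would unfold the product measure, hence
   the following instances at [torus]. *)
Lemma torus_L2M f g : L2 f -> L2 g -> itg torus (fun x => f x * g x).
Proof. by move=> fL gL; exact: (@L2M _ _ _ torus f g fL gL). Qed.

Lemma torus_L2_measurable f : L2 f -> measurable_fun setT (f : mR * mR -> mR).
Proof. by move=> fL; exact: (@L2_measurable _ _ _ torus f fL). Qed.

Lemma torus_CauchySchwarz f g : L2 f -> L2 g ->
  `|\int[torus]_x (f x * g x)| <=
  Num.sqrt (\int[torus]_x f x ^+ 2) * Num.sqrt (\int[torus]_x g x ^+ 2).
Proof. by move=> fL gL; exact: (@L2_CauchySchwarz _ _ _ torus f g fL gL). Qed.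

Lemma torus_Rint_sqr_eq0 f : L2 f -> \int[torus]_x f x ^+ 2 = 0 ->
  \forall x \ae torus, f x = 0.
Proof. by move=> fL; exact: (@Rint_sqr_eq0 _ _ _ torus f fL). Qed.

Lemma torus_L2Z a f : L2 f -> L2 (fun x => a * f x).
Proof. by move=> fL; exact: (@L2Z _ _ _ torus a f fL). Qed.

Lemma torus_L2D f g : L2 f -> L2 g -> L2 (fun x => f x + g x).
Proof. by move=> fL gL; exact: (@L2D _ _ _ torus f g fL gL). Qed.

Lemma torus_L2N f : L2 f -> L2 (fun x => - f x).
Proof. by move=> fL; exact: (@L2N _ _ _ torus f fL). Qed.

Lemma torus_L2B f g : L2 f -> L2 g -> L2 (fun x => f x - g x).
Proof. by move=> fL gL; exact: (@L2B _ _ _ torus f g fL gL). Qed.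

Lemma torus_L2_sum (I : Type) (r : seq I) (P : pred I) (F : I -> R * R -> R) :
  (forall i, L2 (F i)) -> L2 (fun x => \sum_(i <- r | P i) F i x).
Proof. by move=> FL; exact: (@L2_sum _ _ _ torus I r P F FL). Qed.

Lemma torus_L2P f : L2 f <->
  measurable_fun setT (f : mR * mR -> R) /\ itg torus (fun x => f x ^+ 2).
Proof. exact: (@L2P _ _ _ torus f). Qed.

End TorusMeasure.

#[global] Hint Resolve circle_ae_filter torus_ae_filter : typeclass_instances.

(** * Trigonometric polynomials *)

Section TrigonometricPolynomials.
Context (R : realType).
Local Notation torus := (torus R).
Implicit Types (f g h p q : R * R -> R) (k l : int * int) (x v y : R * R).

(** Products are not among the constructors, so that inductions only meet linear cases; [trigpolyM]
    recovers them. *)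
Inductive trigpoly : (R * R -> R) -> Prop :=
| trigpoly_cos k : trigpoly (fun x => cos (phase k x))
| trigpoly_sin k : trigpoly (fun x => sin (phase k x))
| trigpolyD p q : trigpoly p -> trigpoly q -> trigpoly (fun x => p x + q x)
| trigpolyZ a p : trigpoly p -> trigpoly (fun x => a * p x).

Lemma phase0 (x : R * R) : phase 0 x = 0.
Proof. by rewrite /phase/= !mul0r addr0. Qed.

Lemma phaseD k l (x : R * R) : phase (k + l) x = phase k x + phase l x.
Proof. by rewrite /phase/= !intrD; ring. Qed.

Lemma phaseN k (x : R * R) : phase (- k) x = - phase k x.
Proof. by rewrite /phase/= !mulrNz; ring. Qed.

Lemma phaseB k l (x : R * R) : phase (k - l) x = phase k x - phase l x.
Proof. by rewrite phaseD phaseN. Qed.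

Lemma phase_line k (x v : R * R) t :
  phase k (x + t *: v) = phase k x + t * phase k v.
Proof.
rewrite /phase /= -[t *: v.1]/(t * v.1) -[t *: v.2]/(t * v.2); ring.
Qed.

Lemma trigpoly_cst c : trigpoly (fun=> c).
Proof.
have -> : (fun=> c) = (fun x => c * cos (phase 0 x)).
  by apply/funext => x; rewrite phase0 cos0 mulr1.
exact/trigpolyZ/trigpoly_cos.
Qed.

Lemma trigpolyN p : trigpoly p -> trigpoly (fun x => - p x).
Proof.
have -> : (fun x => - p x) = (fun x => -1 * p x).
  by apply/funext => x; rewrite mulN1r.
exact: trigpolyZ.
Qed.

Lemma trigpolyB p q : trigpoly p -> trigpoly q -> trigpoly (fun x => p x - q x).
Proof. by move=> tp tq; apply: trigpolyD => //; exact: trigpolyN. Qed.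

Lemma trigpoly_sum (I : Type) (r : seq I) (P : pred I) (F : I -> R * R -> R) :
  (forall i, trigpoly (F i)) ->
  trigpoly (fun x => \sum_(i <- r | P i) F i x).
Proof.
move=> tF; elim: r => [|i r IH].
  under [X in trigpoly X]eq_fun do rewrite big_nil; exact: trigpoly_cst.
under [X in trigpoly X]eq_fun do rewrite big_cons.
by case: (P i) => //; exact: trigpolyD.
Qed.

(** The four base cases are the product-to-sum formulas. *)
Lemma trigpolyM p q : trigpoly p -> trigpoly q -> trigpoly (fun x => p x * q x).
Proof.
have half (a b c : R * R -> R) : trigpoly a -> trigpoly b ->
    (forall x, c x = 2^-1 * (a x + b x)) -> trigpoly c.
  move=> ta tb cE; have -> : c = (fun x => 2^-1 * (a x + b x)) by exact/funext.
  exact/trigpolyZ/trigpolyD.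
have two : 2^-1 * 2 = 1 :> R by rewrite mulVf.
move=> tp tq; elim: tp => [k|k|p1 p2 _ IH1 _ IH2|a p1 _ IH]; last 2 first.
- by under [X in trigpoly X]eq_fun do rewrite mulrDl; exact: trigpolyD.
- by under [X in trigpoly X]eq_fun do rewrite -mulrA; exact: trigpolyZ.
- elim: tq => [l|l|q1 q2 _ IH1 _ IH2|a q1 _ IH]; last 2 first.
  + by under [X in trigpoly X]eq_fun do rewrite mulrDr; exact: trigpolyD.
  + by under [X in trigpoly X]eq_fun do rewrite mulrCA; exact: trigpolyZ.
  + apply: (half _ _ _ (trigpoly_cos (k + l)) (trigpoly_cos (k - l))) => x.
    by rewrite phaseB phaseD cosB cosD; lra.
  + apply: (half _ _ _ (trigpoly_sin (k + l)) (trigpolyN (trigpoly_sin (k - l)))) => x.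
    by rewrite phaseB phaseD sinB sinD; lra.
- elim: tq => [l|l|q1 q2 _ IH1 _ IH2|a q1 _ IH]; last 2 first.
  + by under [X in trigpoly X]eq_fun do rewrite mulrDr; exact: trigpolyD.
  + by under [X in trigpoly X]eq_fun do rewrite mulrCA; exact: trigpolyZ.
  + apply: (half _ _ _ (trigpoly_sin (k + l)) (trigpoly_sin (k - l))) => x.
    by rewrite phaseB phaseD sinB sinD; lra.
  + apply: (half _ _ _ (trigpoly_cos (k - l)) (trigpolyN (trigpoly_cos (k + l)))) => x.
    by rewrite phaseB phaseD cosB cosD; lra.
Qed.

Lemma trigpolyX p n : trigpoly p -> trigpoly (fun x => p x ^+ n).
Proof.
move=> tp; elim: n => [|n IH]; first exact: trigpoly_cst.
by under [X in trigpoly X]eq_fun do rewrite exprS; exact: trigpolyM.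
Qed.

(** A directional derivative is a one-variable derivative at 0 along the line, so the one-variable
    chain rule suffices and no differential in the plane is required. *)
Lemma is_derive_line f x v df :
  is_derive (0 : R) (1 : R) (fun s : R => f (x + s *: v)) df -> is_derive x v f df.
Proof.
have E : (fun h : R => h^-1 *: (((fun s : R => f (x + s *: v)) \o shift 0) (h *: 1) -
    f (x + 0 *: v))) =
  (fun h : R => h^-1 *: ((f \o shift x) (h *: v) - f x)).
  apply/funext => h /=; have -> : h *: (1 : R) = h by exact: mulr1.
  by rewrite addr0 scale0r addr0 (addrC x).
case; rewrite /derivable /derive E => dl dv.
by split; rewrite /derivable /derive.
Qed.

Lemma is_derive_affine (a c : R) (F : R -> R) F' :
  is_derive a (1 : R) F F' -> is_derive (0 : R) (1 : R) (fun s : R => F (a + s * c)) (F' * c).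
Proof.
move=> dF; apply: (@is_derive1_comp _ F (fun s : R => a + s * c)).
  rewrite /= mul0r addr0; exact: dF.
have dM : is_derive (0 : R) (1 : R) (fun s : R => s * c) c.
  have := @is_deriveM R R id (cst c) 0 1 1 0 (is_derive_id _ _) (is_derive_cst _ _ _).
  by move=> dM; apply: is_derive_eq dM _; rewrite scaler0 add0r; exact: mulr1.
have := @is_deriveD R R R (cst a) (fun s : R => s * c) 0 1 0 c (is_derive_cst _ _ _) dM.
by rewrite add0r.
Qed.

Lemma is_derive_cos_phase k x v :
  is_derive x v (fun x : R * R => cos (phase k x)) (- phase k v * sin (phase k x)).
Proof.
apply: is_derive_line.
rewrite (_ : (fun s => _) = (fun s => cos (phase k x + s * phase k v))); last first.
  by apply/funext => s; rewrite phase_line.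
by rewrite mulNr mulrC -mulNr; apply: is_derive_affine.
Qed.

Lemma is_derive_sin_phase k x v :
  is_derive x v (fun x : R * R => sin (phase k x)) (phase k v * cos (phase k x)).
Proof.
apply: is_derive_line.
rewrite (_ : (fun s => _) = (fun s => sin (phase k x + s * phase k v))); last first.
  by apply/funext => s; rewrite phase_line.
by rewrite mulrC; apply: is_derive_affine.
Qed.

Lemma trigpoly_is_derive p v : trigpoly p ->
  exists2 q, trigpoly q & forall x, is_derive x v p (q x).
Proof.
elim=> [k|k|p1 p2 _ [q1 t1 d1] _ [q2 t2 d2]|a p1 _ [q1 t1 d1]].
- exists (fun x => - phase k v * sin (phase k x)); first exact/trigpolyZ/trigpoly_sin.
  by move=> x; exact: is_derive_cos_phase.
- exists (fun x => phase k v * cos (phase k x)); first exact/trigpolyZ/trigpoly_cos.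
  by move=> x; exact: is_derive_sin_phase.
- exists (fun x => q1 x + q2 x); first exact: trigpolyD.
  by move=> x; apply: is_deriveD.
- exists (fun x => a * q1 x); first exact: trigpolyZ.
  by move=> x; apply: is_deriveZ.
Qed.

Lemma trigpoly_derivable p x v : trigpoly p -> derivable p x v.
Proof. by case/(trigpoly_is_derive v) => q _ /(_ x) []. Qed.

Lemma trigpoly_partial j p : trigpoly p -> trigpoly (partial j p).
Proof.
case/(trigpoly_is_derive (dir R j)) => q tq dq.
suff -> : partial j p = q by [].
by apply/funext => x; case: (dq x).
Qed.

Lemma partial_cos j k :
  partial j (fun x : R * R => cos (phase k x)) =
  (fun x => - phase k (dir R j) * sin (phase k x)).
Proof.
by apply/funext => x; case: (is_derive_cos_phase k x (dir R j)).
Qed.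

Lemma partial_sin j k :
  partial j (fun x : R * R => sin (phase k x)) =
  (fun x => phase k (dir R j) * cos (phase k x)).
Proof.
by apply/funext => x; case: (is_derive_sin_phase k x (dir R j)).
Qed.

Lemma partialD j p q x : derivable p x (dir R j) -> derivable q x (dir R j) ->
  partial j (fun x => p x + q x) x = partial j p x + partial j q x.
Proof. by move=> dp dq; exact: deriveD. Qed.

Lemma partialZ j a p x : derivable p x (dir R j) ->
  partial j (fun x => a * p x) x = a * partial j p x.
Proof. by move=> dp; exact: deriveZ. Qed.

Lemma partialM j p q x : derivable p x (dir R j) -> derivable q x (dir R j) ->
  partial j (fun x => p x * q x) x = p x * partial j q x + q x * partial j p x.
Proof. by move=> dp dq; exact: (deriveM dp dq). Qed.

Lemma partial_sum j (I : Type) (r : seq I) (F : I -> R * R -> R) :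
  (forall i, trigpoly (F i)) ->
  partial j (fun x => \sum_(i <- r) F i x) =
  (fun x => \sum_(i <- r) partial j (F i) x).
Proof.
move=> tF; apply/funext => x; elim: r => [|i r IH].
  rewrite big_nil /partial; under [X in derive X]eq_fun do rewrite big_nil.
  exact: derive_cst.
rewrite big_cons -IH -partialD; last 2 first.
- exact: trigpoly_derivable.
- by apply: trigpoly_derivable; exact: trigpoly_sum.
by congr (partial j _ x); apply/funext => y; rewrite big_cons.
Qed.

Lemma phase_continuous k : continuous (fun x : R * R => phase k x).
Proof.
move=> x; apply: (@cvgD _ _ _ _ _ (fun y : R * R => k.1%:~R * y.1)
    (fun y : R * R => k.2%:~R * y.2)).
  by apply: (@cvgMl_tmp _ _ _ _ (fun y : R * R => y.1)); case: x => a b; exact: cvg_fst.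
by apply: (@cvgMl_tmp _ _ _ _ (fun y : R * R => y.2)); case: x => a b; exact: cvg_snd.
Qed.

Lemma trigpoly_continuous p : trigpoly p -> continuous p.
Proof.
elim=> [k|k|p1 p2 _ c1 _ c2|a p1 _ c1] x.
- exact: (@continuous_comp _ _ _ (phase k) cos x (@phase_continuous k x)
    (@continuous_cos R _)).
- exact: (@continuous_comp _ _ _ (phase k) sin x (@phase_continuous k x)
    (@continuous_sin R _)).
- exact: (@cvgD _ _ _ _ _ p1 p2 _ _ (c1 x) (c2 x)).
- exact: (@cvgMl_tmp _ _ _ _ p1 _ _ (c1 x)).
Qed.

Lemma trigpoly_smooth p : trigpoly p -> smooth p.
Proof.
move=> tp s; have tq : trigpoly (foldr (@partial R) p s).
  by elim: s => [//|j s IH] /=; exact: trigpoly_partial.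
by split=> [|j x]; [exact: trigpoly_continuous|exact: trigpoly_derivable].
Qed.

Lemma cos_sin_2pi_nat (n : nat) :
  cos (n%:R * (2 * pi)) = 1 :> R /\ sin (n%:R * (2 * pi)) = 0 :> R.
Proof.
elim: n => [|n [c s]]; first by rewrite mul0r cos0 sin0.
have E : 2 * pi = pi *+ 2 :> R by rewrite mulr_natl.
rewrite -natr1 mulrDl mul1r cosD sinD c s E cos2pi sin2pi.
by rewrite !mul0r mul1r subr0 mulr0 addr0.
Qed.

Lemma cos_sin_2pi_int (n : int) :
  cos (n%:~R * (2 * pi)) = 1 :> R /\ sin (n%:~R * (2 * pi)) = 0 :> R.
Proof.
case: n => n; first by rewrite -pmulrn; exact: cos_sin_2pi_nat.
rewrite NegzE mulrNz mulNr cosN sinN -pmulrn.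
by have [-> ->] := cos_sin_2pi_nat n.+1; rewrite oppr0.
Qed.

Lemma phase_dir k j : phase k (dir R j) = (if j == ord0 then k.1 else k.2)%:~R.
Proof. by rewrite /phase /dir; case: ifP => _ /=; rewrite mulr1 mulr0 ?addr0 ?add0r. Qed.

Lemma trigpoly_periodic p : trigpoly p -> Defs.periodic p.
Proof.
elim=> [k|k|p1 p2 _ c1 _ c2|a p1 _ c1] j x.
- rewrite phase_line phase_dir mulrC cosD.
  by case: (cos_sin_2pi_int (if j == ord0 then k.1 else k.2)) => -> ->;
    rewrite mulr1 mulr0 subr0.
- rewrite phase_line phase_dir mulrC sinD.
  by case: (cos_sin_2pi_int (if j == ord0 then k.1 else k.2)) => -> ->;
    rewrite mulr1 mulr0 addr0.
- by rewrite c1 c2.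
- by rewrite c1.
Qed.

Lemma trigpoly_L2 p : trigpoly p -> L2 p.
Proof. by move=> tp; exact/continuous_L2/trigpoly_continuous. Qed.

Lemma trigpoly_measurable p : trigpoly p ->
  measurable_fun setT (p : measurableTypeR R * measurableTypeR R -> R).
Proof. by move=> tp; apply: torus_L2_measurable; exact: trigpoly_L2. Qed.

Lemma trigpoly_bounded p : trigpoly p -> exists M, forall x, `|p x| <= M.
Proof.
elim=> [k|k|p1 p2 _ [M1 b1] _ [M2 b2]|a p1 _ [M1 b1]].
- by exists 1 => x; rewrite ler_norml cos_geN1 cos_le1.
- by exists 1 => x; rewrite ler_norml sin_geN1 sin_le1.
- by exists (M1 + M2) => x; rewrite (le_trans (ler_normD _ _))// lerD.
- by exists (`|a| * M1) => x; rewrite normrM ler_wpM2l.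
Qed.

(** The product p psi is periodic, so its partial derivative integrates to 0; the product rule does
    the rest. *)
Lemma Rint_parts j p psi : trigpoly p -> smooth psi -> Defs.periodic psi ->
  \int[torus]_x (p x * partial j psi x) = - \int[torus]_x (partial j p x * psi x).
Proof.
move=> tp spsi ppsi.
have cpsi : continuous psi := (spsi [::]).1.
have cdpsi : continuous (partial j psi) := (spsi [:: j]).1.
have dpsi x : derivable psi x (dir R j) := (spsi [::]).2 j x.
have dp x := @trigpoly_derivable p x (dir R j) tp.
have cp := trigpoly_continuous tp.
have cdp := trigpoly_continuous (trigpoly_partial j tp).
have E : partial j (fun x => p x * psi x) =
    (fun x => p x * partial j psi x + psi x * partial j p x).
  by apply/funext => x; rewrite partialM.
have := @int_partial_eq0 R j (fun x => p x * psi x).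
rewrite E RintD; [|exact: torus_L2M (continuous_L2 cp) (continuous_L2 cdpsi)|
  exact: torus_L2M (continuous_L2 cpsi) (continuous_L2 cdp)].
move=> int0; apply/eqP; rewrite -addr_eq0; apply/eqP.
rewrite -[RHS]int0.
- by congr (_ + _); apply: eq_Rintegral => x _; rewrite mulrC.
- move=> x; apply: (@cvgD _ _ _ _ _ (fun y => p y * partial j psi y)
    (fun y => psi y * partial j p y)).
    exact: (@cvgM _ _ _ _ p (partial j psi) _ _ (cp x) (cdpsi x)).
  exact: (@cvgM _ _ _ _ psi (partial j p) _ _ (cpsi x) (cdp x)).
- by move=> x; exact: (derivableM (dp x) (dpsi x)).
- by move=> i x; rewrite (trigpoly_periodic tp) ppsi.
Qed.

(** For k nonzero some component k_j is nonzero, and k_j cos(k . x) is the j-th partial derivative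
    of the periodic function sin(k . x). *)
Lemma Rint_cos_phase k :
  \int[torus]_x cos (phase k x) = (k == 0)%:R * (2 * pi) ^+ 2.
Proof.
have [->|k0] := eqVneq k 0.
  transitivity (\int[torus]_x (1 : R)).
    by apply: eq_Rintegral => x _; rewrite phase0 cos0.
  rewrite Rintegral_cst// mul1r mul1r.
  by have := torusT R => ->.
rewrite mul0r.
have [j kj] : exists j, phase k (dir R j) != 0.
  case: k k0 => a b; rewrite -pair_eqE/= negb_and => /orP[a0|b0].
    by exists ord0; rewrite phase_dir/= intr_eq0.
  by exists (lift ord0 ord0); rewrite phase_dir/= intr_eq0.
apply: (mulfI kj); rewrite mulr0.
rewrite -RintZ; last exact/L2_itg/trigpoly_L2/trigpoly_cos.
have ts := trigpoly_sin k.
rewrite -[RHS](int_partial_eq0 (j := j) _ _ (trigpoly_periodic ts)).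
- by apply: eq_Rintegral => x _; rewrite partial_sin.
- exact/trigpoly_continuous/trigpoly_partial.
- by move=> x; exact: trigpoly_derivable.
Qed.

Lemma Rint_sin_phase k : \int[torus]_x sin (phase k x) = 0.
Proof.
have [->|k0] := eqVneq k 0.
  transitivity (\int[torus]_x (0 : R)).
    by apply: eq_Rintegral => x _; rewrite phase0 sin0.
  by rewrite Rintegral_cst// mul0r.
have [j kj] : exists j, - phase k (dir R j) != 0.
  case: k k0 => a b; rewrite -pair_eqE/= negb_and => /orP[a0|b0].
    by exists ord0; rewrite phase_dir/= oppr_eq0 intr_eq0.
  by exists (lift ord0 ord0); rewrite phase_dir/= oppr_eq0 intr_eq0.
apply: (mulfI kj); rewrite mulr0.
rewrite -RintZ; last exact/L2_itg/trigpoly_L2/trigpoly_sin.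
have ts := trigpoly_cos k.
rewrite -[RHS](int_partial_eq0 (j := j) _ _ (trigpoly_periodic ts)).
- by apply: eq_Rintegral => x _; rewrite partial_cos.
- exact/trigpoly_continuous/trigpoly_partial.
- by move=> x; exact: trigpoly_derivable.
Qed.

End TrigonometricPolynomials.

(** * The Fourier projections *)

Section FourierProjection.
Context (R : realType).
Local Notation torus := (torus R).
Implicit Types (f g h p q : R * R -> R) (k l : int * int) (m : R).

Lemma eq_Rint f g : (forall x, f x = g x) ->
  \int[torus]_x f x = \int[torus]_x g x.
Proof. by move=> fg; apply: eq_Rintegral => x _. Qed.

Lemma wavenum_normE k :
  wavenum_norm R k ^+ 2 = \sum_(j < 2) phase k (dir R j) ^+ 2.
Proof.
rewrite sqr_sqrtr; last by rewrite ler0z addr_ge0 ?sqr_ge0.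
by rewrite !big_ord_recl big_ord0 !phase_dir/= addr0 intrD !rmorphXn.
Qed.

Lemma wavenum_normN k : wavenum_norm R (- k) = wavenum_norm R k.
Proof. by rewrite /wavenum_norm/= !sqrrN. Qed.

Lemma wavenum_norm0 : wavenum_norm R 0 = 0.
Proof. by rewrite /wavenum_norm/= expr0n addr0 sqrtr0. Qed.

Lemma wavenum_norm_ge1 k : k != 0 -> 1 <= wavenum_norm R k.
Proof.
move=> k0; rewrite -[1]sqrtr1 ler_wsqrtr// (ler_int _ 1).
have : k.1 ^+ 2 + k.2 ^+ 2 != 0.
  apply: contra k0; rewrite paddr_eq0 ?sqr_ge0// !sqrf_eq0 => /andP[/eqP a /eqP b].
  by case: k a b => a b /= -> ->.
have : 0 <= k.1 ^+ 2 + k.2 ^+ 2 by rewrite addr_ge0 ?sqr_ge0.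
by move: (_ + _) => c; lia.
Qed.

Definition disc m : set (int * int) := [set k | wavenum_norm R k <= m].

(** A sum over a set defaults to 0 when its support is infinite; finiteness of the disc is what
    makes [fproj] the intended sum over [modes]. *)
Lemma finite_disc m : finite_set (disc m).
Proof.
pose n := (Num.truncn `|m|).+1.
have bound (a b : int) : wavenum_norm R (a, b) <= m -> (`|a| < n)%N.
  move=> ab; rewrite -(@ltr_nat R) natr_absz -[X in X < _]ger0_norm ?ler0z//.
  apply: le_lt_trans (truncnS_gt `|m|).
  apply: le_trans (ler_norm m); apply: le_trans ab.
  rewrite ger0_norm ?ler0z// /wavenum_norm/= -(ger0_norm (x := `|a|%:~R)) ?ler0z//.
  rewrite -sqrtr_sqr ler_wsqrtr// -rmorphXn ler_int /=.
  by rewrite real_normK ?num_real// lerDl sqr_ge0.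
(* Integers of absolute value below n are the naturals below 2 n shifted down by n. *)
apply: (@sub_finite_set _ _ ((fun u : nat * nat => ((u.1%:Z - n%:Z, u.2%:Z - n%:Z) : int * int))
  @` (`I_(n + n) `*` `I_(n + n)))).
  move=> [a b] kd; have an := bound _ _ kd.
  have bn : (`|b| < n)%N.
    by apply: (bound b a); move: kd; rewrite /disc/= /wavenum_norm/= addrC.
  exists (absz (a + n%:Z)%R, absz (b + n%:Z)%R) => /=; last by congr pair; lia.
  by split => /=; lia.
by apply: finite_image; apply: finite_setX; exact: finite_II.
Qed.

Definition modes m : seq (int * int) := finmap.enum_fset (fset_set (disc m)).

Lemma mem_modes m k : (k \in modes m) = (wavenum_norm R k <= m).
Proof.
have -> : (k \in modes m) = (k \in disc m) := in_fset_set (finite_disc m) k.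
by apply/idP/idP => [/set_mem//|km]; apply/mem_set.
Qed.

Lemma modes_uniq m : uniq (modes m).
Proof. exact: finmap.fset_uniq. Qed.

Lemma fprojE m g : fproj m g = fun x =>
  \sum_(k <- modes m) (fcos g k * cos (phase k x) + fsin g k * sin (phase k x)).
Proof. by apply/funext => x; rewrite /fproj fsbig_finite//; exact: finite_disc. Qed.

Lemma trigpoly_fproj m g : trigpoly (fproj m g).
Proof.
rewrite fprojE; apply: trigpoly_sum => k; apply: trigpolyD; apply: trigpolyZ.
  exact: trigpoly_cos.
exact: trigpoly_sin.
Qed.

Lemma L2_fproj m g : L2 (fproj m g).
Proof. exact/trigpoly_L2/trigpoly_fproj. Qed.

Local Notation A := ((2 * pi) ^+ 2 : R).

Lemma area_neq0 : A != 0.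
Proof. by rewrite expf_neq0// mulf_neq0// gt_eqF// pi_gt0. Qed.

Lemma Rint_cos g k : \int[torus]_x (g x * cos (phase k x)) = A * fcos g k.
Proof. by rewrite /fcos mulVKf// area_neq0. Qed.

Lemma Rint_sin g k : \int[torus]_x (g x * sin (phase k x)) = A * fsin g k.
Proof. by rewrite /fsin mulVKf// area_neq0. Qed.

Lemma fcosD f g k : L2 f -> L2 g ->
  fcos (fun x => f x + g x) k = fcos f k + fcos g k.
Proof.
move=> fL gL; have tk := trigpoly_L2 (trigpoly_cos R k).
rewrite /fcos -mulrDr -RintD; [|exact: torus_L2M|exact: torus_L2M].
by congr (_ * _); apply: eq_Rint => x; rewrite mulrDl.
Qed.

Lemma fsinD f g k : L2 f -> L2 g ->
  fsin (fun x => f x + g x) k = fsin f k + fsin g k.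
Proof.
move=> fL gL; have tk := trigpoly_L2 (trigpoly_sin R k).
rewrite /fsin -mulrDr -RintD; [|exact: torus_L2M|exact: torus_L2M].
by congr (_ * _); apply: eq_Rint => x; rewrite mulrDl.
Qed.

Lemma fcosZ a f k : L2 f -> fcos (fun x => a * f x) k = a * fcos f k.
Proof.
move=> fL; have tk := trigpoly_L2 (trigpoly_cos R k).
rewrite /fcos mulrCA -(RintZ a); last exact: torus_L2M.
by congr (_ * _); apply: eq_Rint => x; rewrite mulrA.
Qed.

Lemma fsinZ a f k : L2 f -> fsin (fun x => a * f x) k = a * fsin f k.
Proof.
move=> fL; have tk := trigpoly_L2 (trigpoly_sin R k).
rewrite /fsin mulrCA -(RintZ a); last exact: torus_L2M.
by congr (_ * _); apply: eq_Rint => x; rewrite mulrA.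
Qed.

Lemma fprojD m f g : L2 f -> L2 g ->
  fproj m (fun x => f x + g x) = fun x => fproj m f x + fproj m g x.
Proof.
move=> fL gL; rewrite !fprojE; apply/funext => x; rewrite -big_split/=.
by apply: eq_bigr => k _; rewrite fcosD// fsinD//; ring.
Qed.

Lemma fprojZ m a f : L2 f ->
  fproj m (fun x => a * f x) = fun x => a * fproj m f x.
Proof.
move=> fL; rewrite !fprojE; apply/funext => x; rewrite mulr_sumr.
by apply: eq_bigr => k _; rewrite fcosZ// fsinZ//; ring.
Qed.

Lemma fprojB m f g : L2 f -> L2 g ->
  fproj m (fun x => f x - g x) = fun x => fproj m f x - fproj m g x.
Proof.
move=> fL gL.
rewrite (_ : (fun x => f x - g x) = (fun x => f x + -1 * g x)); last first.
  by apply/funext => x; rewrite mulN1r.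
rewrite fprojD//; last exact: torus_L2Z.
by rewrite fprojZ//; apply/funext => x; rewrite mulN1r.
Qed.

Lemma Rint_fproj m g h : L2 h -> \int[torus]_x (fproj m g x * h x) =
  A * \sum_(k <- modes m) (fcos g k * fcos h k + fsin g k * fsin h k).
Proof.
move=> hL.
pose F k x := fcos g k * (h x * cos (phase k x)) + fsin g k * (h x * sin (phase k x)).
have Lc k : itg torus (fun x => h x * cos (phase k x)).
  exact: torus_L2M hL (trigpoly_L2 (trigpoly_cos R k)).
have Ls k : itg torus (fun x => h x * sin (phase k x)).
  exact: torus_L2M hL (trigpoly_L2 (trigpoly_sin R k)).
transitivity (\int[torus]_x \sum_(k <- modes m) F k x).
  apply: eq_Rint => x; rewrite fprojE mulr_suml.
  by apply: eq_bigr => k _; rewrite /F; ring.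
rewrite Rint_sum; last by move=> k; apply: itgD; exact: itgZ.
rewrite mulr_sumr; apply: eq_bigr => k _.
rewrite RintD; [|exact: itgZ|exact: itgZ].
by rewrite !RintZ// Rint_cos Rint_sin; ring.
Qed.

(** The expression in Fourier coefficients given by [Rint_fproj] is symmetric in g and h. *)
Lemma Rint_fprojC m g h : L2 g -> L2 h ->
  \int[torus]_x (fproj m g x * h x) = \int[torus]_x (g x * fproj m h x).
Proof.
move=> gL hL; rewrite Rint_fproj//.
under [RHS]eq_Rintegral do rewrite mulrC.
by rewrite Rint_fproj//; congr (_ * _); apply: eq_bigr => k _; ring.
Qed.

Let delta k l : R := (k == l)%:R.

Let Rcos := Rint_cos_phase R.
Let Rsin := Rint_sin_phase R.

Let Rint_half f g h : trigpoly f -> trigpoly g ->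
  (forall x, h x = 2^-1 * f x + 2^-1 * g x) ->
  \int[torus]_x h x = 2^-1 * \int[torus]_x f x + 2^-1 * \int[torus]_x g x.
Proof.
move=> tf tg hE; have fi := L2_itg (trigpoly_L2 tf); have gi := L2_itg (trigpoly_L2 tg).
by rewrite (eq_Rint hE) RintD ?RintZ//; exact: itgZ.
Qed.

(** The index runs over all of Z^2, where l and - l give the same cosine: each of them receives half
    of the mode, and for l = 0 the two halves coincide and add up to 1. *)
Lemma fcos_cos k l :
  fcos (fun x : R * R => cos (phase l x)) k = 2^-1 * (delta k l + delta (- k) l).
Proof.
apply: (mulfI area_neq0); rewrite -Rint_cos.
rewrite (@Rint_half (fun x => cos (phase (l - k) x)) (fun x => cos (phase (l + k) x))).
- rewrite !Rcos subr_eq0 addr_eq0 /delta (eq_sym k) (eq_sym (- k)); ring.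
- exact: trigpoly_cos.
- exact: trigpoly_cos.
- by move=> x; rewrite phaseB phaseD cosB cosD; lra.
Qed.

Lemma fsin_cos k l : fsin (fun x : R * R => cos (phase l x)) k = 0.
Proof.
apply: (mulfI area_neq0); rewrite -Rint_sin mulr0.
rewrite (@Rint_half (fun x => sin (phase (k - l) x)) (fun x => sin (phase (k + l) x))).
- by rewrite !Rsin !mulr0 addr0.
- exact: trigpoly_sin.
- exact: trigpoly_sin.
- by move=> x; rewrite phaseB phaseD sinB sinD; lra.
Qed.

Lemma fcos_sin k l : fcos (fun x : R * R => sin (phase l x)) k = 0.
Proof.
apply: (mulfI area_neq0); rewrite -Rint_cos mulr0.
rewrite (@Rint_half (fun x => sin (phase (l - k) x)) (fun x => sin (phase (l + k) x))).
- by rewrite !Rsin !mulr0 addr0.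
- exact: trigpoly_sin.
- exact: trigpoly_sin.
- by move=> x; rewrite phaseB phaseD sinB sinD; lra.
Qed.

Lemma fsin_sin k l :
  fsin (fun x : R * R => sin (phase l x)) k = 2^-1 * (delta k l - delta (- k) l).
Proof.
apply: (mulfI area_neq0); rewrite -Rint_sin.
rewrite (@Rint_half (fun x => cos (phase (l - k) x)) (fun x => - cos (phase (l + k) x))).
- rewrite RintN; last exact/L2_itg/trigpoly_L2/trigpoly_cos.
  rewrite !Rcos subr_eq0 addr_eq0 /delta (eq_sym k) (eq_sym (- k)); ring.
- exact: trigpoly_cos.
- exact/trigpolyN/trigpoly_cos.
- by move=> x; rewrite phaseB phaseD cosB cosD; lra.
Qed.

Let sum_delta (r : seq (int * int)) l (F : int * int -> R) : uniq r ->
  \sum_(k <- r) delta k l * F k = if l \in r then F l else 0.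
Proof.
elim: r => [|k r IH]; first by rewrite big_nil.
rewrite cons_uniq big_cons in_cons => /andP[kr /IH ->].
rewrite /delta (eq_sym l); have [<-|kl] /= := eqVneq k l.
  by rewrite (negbTE kr) mul1r addr0.
by rewrite mul0r add0r.
Qed.

Let sum_deltaN (r : seq (int * int)) l (F : int * int -> R) : uniq r ->
  \sum_(k <- r) delta (- k) l * F k = if - l \in r then F (- l) else 0.
Proof.
move=> ur; rewrite -sum_delta//; apply: eq_bigr => k _.
by rewrite /delta eqr_oppLR.
Qed.

Lemma fproj_cos m l : fproj m (fun x : R * R => cos (phase l x)) =
  if wavenum_norm R l <= m then (fun x => cos (phase l x)) else (fun=> 0).
Proof.
rewrite fprojE; apply/funext => x.
transitivity (\sum_(k <- modes m) (delta k l * (2^-1 * cos (phase k x)) +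
    delta (- k) l * (2^-1 * cos (phase k x)))).
  by apply: eq_bigr => k _; rewrite fsin_cos fcos_cos; ring.
rewrite big_split/= sum_delta ?modes_uniq// sum_deltaN ?modes_uniq//.
rewrite !mem_modes wavenum_normN; case: ifP => _; last by rewrite addr0.
by rewrite phaseN cosN; lra.
Qed.

Lemma fproj_sin m l : fproj m (fun x : R * R => sin (phase l x)) =
  if wavenum_norm R l <= m then (fun x => sin (phase l x)) else (fun=> 0).
Proof.
rewrite fprojE; apply/funext => x.
transitivity (\sum_(k <- modes m) (delta k l * (2^-1 * sin (phase k x)) +
    delta (- k) l * (- 2^-1 * sin (phase k x)))).
  by apply: eq_bigr => k _; rewrite fcos_sin fsin_sin; ring.
rewrite big_split/= sum_delta ?modes_uniq// sum_deltaN ?modes_uniq//.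
rewrite !mem_modes wavenum_normN; case: ifP => _; last by rewrite addr0.
by rewrite phaseN sinN; lra.
Qed.

Lemma fproj_trigpoly p : trigpoly p -> exists M, forall m, M <= m -> fproj m p = p.
Proof.
elim=> [k|k|p1 p2 t1 [M1 h1] t2 [M2 h2]|a p1 t1 [M1 h1]].
- by exists (wavenum_norm R k) => m km; rewrite fproj_cos km.
- by exists (wavenum_norm R k) => m km; rewrite fproj_sin km.
- exists (Num.max M1 M2) => m; rewrite ge_max => /andP[m1 m2].
  by rewrite fprojD ?h1 ?h2//; exact: trigpoly_L2.
- by exists M1 => m m1; rewrite fprojZ ?h1//; exact: trigpoly_L2.
Qed.

Lemma fcos_fproj m g k : L2 g ->
  fcos (fproj m g) k = if wavenum_norm R k <= m then fcos g k else 0.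
Proof.
move=> gL; apply: (mulfI area_neq0); rewrite -Rint_cos Rint_fprojC//; last first.
  exact/trigpoly_L2/trigpoly_cos.
rewrite fproj_cos; case: ifP => _; first by rewrite Rint_cos.
by under eq_Rintegral do rewrite mulr0; rewrite Rintegral_cst// mul0r mulr0.
Qed.

Lemma fsin_fproj m g k : L2 g ->
  fsin (fproj m g) k = if wavenum_norm R k <= m then fsin g k else 0.
Proof.
move=> gL; apply: (mulfI area_neq0); rewrite -Rint_sin Rint_fprojC//; last first.
  exact/trigpoly_L2/trigpoly_sin.
rewrite fproj_sin; case: ifP => _; first by rewrite Rint_sin.
by under eq_Rintegral do rewrite mulr0; rewrite Rintegral_cst// mul0r mulr0.
Qed.

Lemma fproj_idem m g : L2 g -> fproj m (fproj m g) = fproj m g.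
Proof.
move=> gL; rewrite [LHS]fprojE [RHS]fprojE; apply/funext => x.
rewrite big_seq [RHS]big_seq; apply: eq_bigr => k; rewrite mem_modes => km.
by rewrite fcos_fproj// fsin_fproj// km.
Qed.

Lemma Rint_fproj_self m g : L2 g ->
  \int[torus]_x (g x * fproj m g x) = \int[torus]_x fproj m g x ^+ 2.
Proof.
by move=> gL; rewrite -{1}(fproj_idem m gL) -Rint_fprojC//; exact: L2_fproj.
Qed.

Lemma Rint_sqr_fproj m g : L2 g -> \int[torus]_x fproj m g x ^+ 2 =
  A * \sum_(k <- modes m) (fcos g k ^+ 2 + fsin g k ^+ 2).
Proof.
move=> gL; rewrite -Rint_fproj_self//.
under eq_Rintegral do rewrite mulrC.
by rewrite Rint_fproj//; congr (_ * _); apply: eq_bigr => k _; rewrite !expr2.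
Qed.

(** Pythagoras, from the orthogonality expressed by [Rint_fproj_self]. *)
Lemma Rint_sqr_fproj_compl m g : L2 g ->
  \int[torus]_x (g x - fproj m g x) ^+ 2 =
  \int[torus]_x g x ^+ 2 - \int[torus]_x fproj m g x ^+ 2.
Proof.
move=> gL; have pL := L2_fproj m g.
have [_ g2] := (torus_L2P _).1 gL; have [_ p2] := (torus_L2P _).1 pL.
have gp := torus_L2M gL pL.
transitivity (\int[torus]_x (g x ^+ 2 + ((-2) * (g x * fproj m g x) + fproj m g x ^+ 2))).
  by apply: eq_Rint => x; ring.
have i1 := itgZ (-2) gp.
rewrite RintD//; last exact: itgD.
rewrite RintD// RintZ// Rint_fproj_self//; ring.
Qed.

Lemma Bessel m g : L2 g -> \int[torus]_x fproj m g x ^+ 2 <= \int[torus]_x g x ^+ 2.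
Proof.
by move=> gL; rewrite -subr_ge0 -Rint_sqr_fproj_compl// Rint_sqr_ge0.
Qed.

Lemma Rint_sqr_fproj_compl_le m g : L2 g ->
  \int[torus]_x (g x - fproj m g x) ^+ 2 <= \int[torus]_x g x ^+ 2.
Proof. by move=> gL; rewrite Rint_sqr_fproj_compl// gerBl Rint_sqr_ge0. Qed.

End FourierProjection.

(** * Density of the trigonometric polynomials *)

Section StepApproximation.
Context (R : realType).
Implicit Types (a s t : R).

(* The polynomials of Brosowski and Deutsch, which converge to the indicator
   function of [s < 1/2] on [0, 1]. *)
Definition step_poly (n : nat) s : R := (1 - s ^+ n) ^+ (2 ^ n).

Lemma step_poly01 n s : 0 <= s -> s <= 1 -> 0 <= step_poly n s <= 1.
Proof.
move=> s0 s1; have sn1 : s ^+ n <= 1 by exact: exprn_ile1.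
have sn0 : 0 <= s ^+ n by exact: exprn_ge0.
by rewrite /step_poly exprn_ge0 ?subr_ge0//= exprn_ile1 ?subr_ge0// gerBl.
Qed.

Lemma bernoulli_le (x : R) (N : nat) : 0 <= x -> x <= 1 ->
  1 - N%:R * x <= (1 - x) ^+ N.
Proof.
move=> x0 x1; elim: N => [|N IH]; first by rewrite mul0r subr0.
rewrite exprS -natr1.
have h : 0 <= 1 - x by lra.
have := ler_wpM2l h IH; apply: le_trans.
have := mulr_ge0 (ler0n R N) (mulr_ge0 x0 x0); lra.
Qed.

(** N x <= (1 + x)^N, and (1 - x)^N (1 + x)^N = (1 - x^2)^N <= 1. *)
Lemma bernoulli_inv_le (x : R) (N : nat) : 0 <= x -> x <= 1 ->
  (1 - x) ^+ N * (N%:R * x) <= 1.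
Proof.
move=> x0 x1.
have h : (N%:R * x) <= (1 + x) ^+ N.
  elim: N => [|N IH]; first by rewrite mul0r.
  rewrite exprS -natr1 mulrDl mul1r.
  have : 1 <= (1 + x) ^+ N by rewrite exprn_ege1// lerDl.
  have := exprn_ge0 N (addr_ge0 ler01 x0); nra.
apply: (@le_trans _ _ ((1 - x) ^+ N * (1 + x) ^+ N)).
  by apply: ler_wpM2l => //; rewrite exprn_ge0// subr_ge0.
rewrite -exprMn exprn_ile1//; nra.
Qed.

(** The threshold is 1/2 because 2^n s^n = (2 s)^n: the two Bernoulli bounds give at least 1 - (2
    s)^n below it and at most (2 s)^(-n) above it. At s = 1/2 the limit is 1/e, whence the
    exclusion. *)
Lemma step_poly_cvg s : 0 <= s -> s <= 1 -> s != 2^-1 ->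
  step_poly n s @[n --> \oo] --> ((s < 2^-1)%R%:R : R).
Proof.
move=> s0 s1 s2; have [sl|sl] := ltP s 2^-1.
  apply: (@squeeze_cvgr _ _ _ _ (fun n => 1 - (2 * s) ^+ n) (fun=> 1)); last 2 first.
  - rewrite -[X in _ --> X]subr0.
    apply: cvgB; first exact: cvg_cst.
    by apply: cvg_expr; rewrite ger0_norm; lra.
  - exact: cvg_cst.
  apply: nearW => n; have /andP[_ ->] := step_poly01 n s0 s1; rewrite andbT.
  apply: le_trans (bernoulli_le _ _ _); last exact: exprn_ile1.
    by rewrite exprMn natrX.
  exact: exprn_ge0.
have {sl s2} sl : 2^-1 < s by rewrite lt_neqAle eq_sym s2.
apply: (@squeeze_cvgr _ _ _ _ (fun=> 0) (fun n => ((2 * s)^-1) ^+ n)); last 2 first.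
- exact: cvg_cst.
- apply: cvg_expr; rewrite ger0_norm; last by rewrite invr_ge0; lra.
  by rewrite invf_lt1; lra.
apply: nearW => n; have /andP[-> _] /= := step_poly01 n s0 s1.
have p0 : 0 < (2 * s) ^+ n by rewrite exprn_gt0//; lra.
rewrite exprVn -[leRHS]mul1r ler_pdivlMr//.
rewrite exprMn -natrX; apply: bernoulli_inv_le; [exact: exprn_ge0|exact: exprn_ile1].
Qed.

(** A difference of cosines lies in [-2, 2], so the factor 1/4 and the shift by 1/2 bring it into
    [0, 1], with its zeros at the threshold 1/2 of [step_poly]. *)
Definition arc_height a t : R := 2^-1 - 4^-1 * (cos (t - a / 2) - cos (a / 2)).

Lemma arc_height01 a t : 0 <= arc_height a t <= 1.
Proof.
rewrite /arc_height.
have := cos_le1 (t - a / 2); have := cos_le1 (a / 2).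
have := cos_geN1 (t - a / 2); have := cos_geN1 (a / 2).
by move=> *; apply/andP; split; lra.
Qed.

(* cos (t - a/2) - cos (a/2) = 2 sin (t/2) sin ((a - t)/2) has the sign of
   a - t on the period. *)
Lemma arc_height_lt a t : 0 <= a <= 2 * pi -> t \in `]0, 2 * pi[ ->
  (t < a -> arc_height a t < 2^-1) /\ (a < t -> 2^-1 < arc_height a t).
Proof.
move=> /andP[a0 a1]; rewrite in_itv/= => /andP[t0 t1].
have E : cos (t - a / 2) - cos (a / 2) = 2 * (sin (t / 2) * sin ((a - t) / 2)).
  have -> : t - a / 2 = t / 2 - (a - t) / 2 by lra.
  have -> : a / 2 = t / 2 + (a - t) / 2 by lra.
  by rewrite cosB cosD; lra.
have st : 0 < sin (t / 2) by apply: sin_gt0_pi; lra.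
rewrite /arc_height E; split=> h.
  have su : 0 < sin ((a - t) / 2) by apply: sin_gt0_pi; lra.
  by have := mulr_gt0 st su; lra.
have su : 0 < sin ((t - a) / 2) by apply: sin_gt0_pi; lra.
have -> : (a - t) / 2 = - ((t - a) / 2) by lra.
by rewrite sinN; have := mulr_gt0 st su; lra.
Qed.

(** [arc_height_lt] requires a on the closed period. Clamping a to it does not change the truth of t
    < a for t inside the period. *)
Definition step_trig (a : R) (n : nat) t : R :=
  step_poly n (arc_height (Num.min (Num.max 0 a) (2 * pi)) t).

Lemma step_trig01 a n t : 0 <= step_trig a n t <= 1.
Proof. by apply: step_poly01; have /andP[] := arc_height01 (Num.min (Num.max 0 a) (2 * pi)) t. Qed.

Lemma step_trig_cvg a t : t \in `]0, 2 * pi[ -> t != a ->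
  step_trig a n t @[n --> \oo] --> ((t < a)%R%:R : R).
Proof.
move=> t02 ta; rewrite /step_trig; set b := Num.min _ _.
have pi0 := pi_gt0 R.
have b02 : 0 <= b <= 2 * pi.
  by rewrite /b le_min le_max lexx/= ge_min lexx orbT mulr_ge0// ltW.
have [ltb gtb] := arc_height_lt b02 t02.
have /andP[h0 h1] := arc_height01 b t.
move: t02; rewrite in_itv/= => /andP[t0 t1].
have -> : (t < a) = (arc_height b t < 2^-1).
  have [lta|ata] := ltP t a; apply/esym.
    by apply: ltb; rewrite /b lt_min t1 lt_max lta orbT.
  apply/negbTE; rewrite -leNgt; apply/ltW/gtb.
  have {}ata : a < t by rewrite lt_neqAle eq_sym ta.
  by rewrite /b gt_min gt_max t0 ata.
apply: step_poly_cvg => //.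
have [lta|ata] := ltP t a.
  by rewrite lt_eqF//; apply: ltb; rewrite /b lt_min t1 lt_max lta orbT.
have {}ata : a < t by rewrite lt_neqAle eq_sym ta.
rewrite gt_eqF//; apply: gtb.
by rewrite /b gt_min gt_max t0 ata.
Qed.

Lemma trigpoly_step_trig1 a n : trigpoly (fun x : R * R => step_trig a n x.1).
Proof.
rewrite /step_trig /step_poly /arc_height; set b := Num.min _ _.
apply/trigpolyX/trigpolyB/trigpolyX; first exact: trigpoly_cst.
apply/trigpolyB/trigpolyZ/trigpolyB; [exact: trigpoly_cst| |exact: trigpoly_cst].
under [X in trigpoly X]eq_fun do rewrite cosB mulrC (mulrC (sin _)).
have E (x : R * R) : x.1 = phase (1, 0) x by rewrite /phase/= mul1r mul0r addr0.
apply: trigpolyD; apply: trigpolyZ; under [X in trigpoly X]eq_fun do rewrite E.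
  exact: trigpoly_cos.
exact: trigpoly_sin.
Qed.

Lemma trigpoly_step_trig2 a n : trigpoly (fun x : R * R => step_trig a n x.2).
Proof.
rewrite /step_trig /step_poly /arc_height; set b := Num.min _ _.
apply/trigpolyX/trigpolyB/trigpolyX; first exact: trigpoly_cst.
apply/trigpolyB/trigpolyZ/trigpolyB; [exact: trigpoly_cst| |exact: trigpoly_cst].
under [X in trigpoly X]eq_fun do rewrite cosB mulrC (mulrC (sin _)).
have E (x : R * R) : x.2 = phase (0, 1) x by rewrite /phase/= mul1r mul0r add0r.
apply: trigpolyD; apply: trigpolyZ; under [X in trigpoly X]eq_fun do rewrite E.
  exact: trigpoly_cos.
exact: trigpoly_sin.
Qed.

End StepApproximation.

(** * From quadrants to measurable sets, and from those to all of L2 *)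

Section Density.
Context (R : realType).
Local Notation torus := (torus R).
Local Notation mR := (measurableTypeR R).
Implicit Types (f g h p q : R * R -> R).

Definition approximable g := L2 g /\
  forall e : R, 0 < e -> exists2 p, trigpoly p & \int[torus]_x (g x - p x) ^+ 2 <= e.

Lemma Rint_sqrD_le f g : L2 f -> L2 g ->
  \int[torus]_x (f x + g x) ^+ 2 <=
  2 * \int[torus]_x f x ^+ 2 + 2 * \int[torus]_x g x ^+ 2.
Proof.
move=> fL gL; have [_ f2] := (torus_L2P _).1 fL; have [_ g2] := (torus_L2P _).1 gL.
have [_ fg2] := (torus_L2P _).1 (torus_L2D fL gL).
rewrite -!RintZ// -RintD; [|exact: itgZ|exact: itgZ].
apply: le_Rint => //; first by apply: itgD; exact: itgZ.
by apply: nearW => x; have := sqr_ge0 (f x - g x); lra.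
Qed.

Lemma approximable_trigpoly p : trigpoly p -> approximable p.
Proof.
move=> tp; split; first exact: trigpoly_L2.
move=> e e0; exists p => //.
under eq_Rintegral do rewrite subrr expr0n.
by rewrite Rintegral_cst// mul0r ltW.
Qed.

Lemma approximable_near g : L2 g ->
  (forall e : R, 0 < e -> exists2 f, approximable f & \int[torus]_x (g x - f x) ^+ 2 <= e) ->
  approximable g.
Proof.
move=> gL gf; split => // e e0.
(* Two errors of e / 4, each doubled by [Rint_sqrD_le]. *)
have e4 : 0 < e / 4 by lra.
have [f [fL /(_ _ e4)[p tp fp]] gfe] := gf _ e4.
exists p => //; have pL := trigpoly_L2 tp.
have := Rint_sqrD_le (torus_L2B gL fL) (torus_L2B fL pL).
rewrite (_ : \int[torus]_x _ = \int[torus]_x (g x - p x) ^+ 2); last first.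
  by apply: eq_Rint => x; congr (_ ^+ 2); lra.
lra.
Qed.

Lemma approximableZ a g : approximable g -> approximable (fun x => a * g x).
Proof.
move=> [gL gA]; split; first exact: torus_L2Z.
(* The added 1 avoids a division by zero when a = 0. *)
move=> e e0; have a0 : 0 < a ^+ 2 + 1 by have := sqr_ge0 a; lra.
have [p tp gp] := gA (e / (a ^+ 2 + 1)) (divr_gt0 e0 a0).
exists (fun x => a * p x); first exact: trigpolyZ.
have pL := trigpoly_L2 tp; have [_ i] := (torus_L2P _).1 (torus_L2B gL pL).
rewrite (_ : \int[torus]_x _ = a ^+ 2 * \int[torus]_x (g x - p x) ^+ 2); last first.
  by rewrite -RintZ//; apply: eq_Rint => x; ring.
move: gp; rewrite ler_pdivlMr// => gp.
have := Rint_sqr_ge0 torus (fun x => g x - p x); nra.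
Qed.

Lemma approximableD f g : approximable f -> approximable g ->
  approximable (fun x => f x + g x).
Proof.
move=> [fL fA] [gL gA]; split; first exact: torus_L2D.
move=> e e0; have e4 : 0 < e / 4 by lra.
have [p tp fp] := fA _ e4; have [q tq gq] := gA _ e4.
have pL := trigpoly_L2 tp; have qL := trigpoly_L2 tq.
exists (fun x => p x + q x); first exact: trigpolyD.
have := Rint_sqrD_le (torus_L2B fL pL) (torus_L2B gL qL).
rewrite (_ : \int[torus]_x _ = \int[torus]_x (f x + g x - (p x + q x)) ^+ 2); last first.
  by apply: eq_Rint => x; congr (_ ^+ 2); lra.
lra.
Qed.

Lemma approximableB f g : approximable f -> approximable g ->
  approximable (fun x => f x - g x).
Proof.
move=> fA /(approximableZ (-1)) gA; have := approximableD fA gA.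
by congr approximable; apply/funext => x; rewrite mulN1r.
Qed.

Lemma approximable_sum (I : Type) (r : seq I) (F : I -> R * R -> R) :
  (forall i, approximable (F i)) ->
  approximable (fun x => \sum_(i <- r) F i x).
Proof.
move=> FA; elim: r => [|i r IH].
  under [X in approximable X]eq_fun do rewrite big_nil.
  exact/approximable_trigpoly/trigpoly_cst.
by under [X in approximable X]eq_fun do rewrite big_cons; exact: approximableD.
Qed.

(** Dominated convergence for (f - f_n)^2, with majorant 4 g^2, turns convergence almost everywhere
    into convergence in L2. *)
Lemma approximable_dominated (f_ : nat -> R * R -> R) f g :
  (forall n, approximable (f_ n)) ->
  measurable_fun setT (f : mR * mR -> R) -> L2 g ->
  (forall n x, `|f_ n x| <= g x) -> (forall x, `|f x| <= g x) ->
  (\forall x \ae torus, f_ n x @[n --> \oo] --> f x) -> approximable f.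
Proof.
move=> fA mf gL fg_ fg cf.
have [mg g2] := (torus_L2P _).1 gL.
have fL : L2 f.
  apply/torus_L2P; split => //; apply: (le_itg _ g2); first exact: measurable_funX.
  by apply: nearW => x; rewrite ger0_norm ?sqr_ge0// -real_normK ?num_real// lerXn2r ?nnegrE// (le_trans _ (fg x)).
apply: approximable_near => // e e0.
have f_L n : L2 (f_ n) := (fA n).1.
have [] := @dominated_convergence _ _ _ torus setT measurableT
  (fun n x => ((f x - f_ n x) ^+ 2)%:E) (fun=> 0%E) (fun x => (4 * g x ^+ 2)%:E).
- move=> n; apply/measurable_EFinP; apply: measurable_funX.
  exact: (torus_L2_measurable (torus_L2B fL (f_L n))).
- exact: measurable_cst.
- apply: filterS cf => x cfx _.
  apply: cvg_EFin; first exact: nearW.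
  rewrite [X in _ --> X](_ : _ = (f x - f x) ^+ 2); last by rewrite subrr expr0n.
  apply: (@cvg_comp _ _ _ (fun n => f x - f_ n x) (fun y : R => y ^+ 2)).
    by apply: cvgB; [exact: cvg_cst|exact: cfx].
  exact: exprn_continuous.
- exact: itgZ.
- apply: nearW => x n _; rewrite /= lee_fin ger0_norm ?sqr_ge0//.
  have h : `|f x - f_ n x| <= 2 * g x.
    by rewrite (le_trans (ler_normB _ _))//; have := fg_ n x; have := fg x; lra.
  rewrite -real_normK ?num_real//; have := normr_ge0 (f x - f_ n x).
  move: h; nra.
move=> _ _; rewrite integral0_eq//= => lim0.
have {}lim0 : \int[torus]_x (f x - f_ n x) ^+ 2 @[n --> \oo] --> (0 : R).
  by move/fine_cvgP: lim0 => [_].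
have /cvgrPdist_le/(_ _ e0) := lim0.
move=> [n _ /(_ n (leqnn n))]; rewrite sub0r normrN => h.
by exists (f_ n) => //; apply: le_trans h; exact: ler_norm.
Qed.

Lemma approximable_ae f g : approximable f -> L2 g ->
  (\forall x \ae torus, f x = g x) -> approximable g.
Proof.
move=> fA gL fg; apply: approximable_near => // e e0; exists f => //.
have fL := fA.1.
rewrite (@Rint_ae _ _ _ torus _ (fun=> 0)); first by rewrite Rintegral_cst// mul0r ltW.
- by apply: measurable_funX; exact: (torus_L2_measurable (torus_L2B gL fL)).
- exact: measurable_cst.
- by apply: filterS fg => x ->; rewrite subrr expr0n.
Qed.

Lemma indic01 (A : set (R * R)) x : 0 <= (\1_A x : R) <= 1.
Proof. by rewrite indicE; case: (x \in A) => /=; rewrite ?ler01 lexx. Qed.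

Lemma L2_indic (A : set (mR * mR)) : measurable A -> L2 (\1_A : R * R -> R).
Proof.
move=> mA; apply: (@L2_bounded _ _ _ torus 1).
- exact: torus_lty.
- exact: measurable_indic.
- by apply: nearW => x; have /andP[a b] := indic01 A x; rewrite ger0_norm.
Qed.

(** Products of one-variable steps converge to the indicator off the lines x_1 = a and x_2 = b and
    inside the open square, that is, almost everywhere. *)
Lemma approximable_quadrant a b :
  approximable (\1_([set x : R * R | x.1 < a] `&` [set x | x.2 < b])).
Proof.
have mQ : measurable ([set x : mR * mR | x.1 < a] `&` [set x | x.2 < b]).
  apply: open_measurable_prod; apply: openI.
    apply: (@open_comp _ _ (fst : R * R -> R) [set t | t < a]); last exact: open_lt.
    by move=> [x y] _; exact: cvg_fst.
  apply: (@open_comp _ _ (snd : R * R -> R) [set t | t < b]); last exact: open_lt.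
  by move=> [x y] _; exact: cvg_snd.
apply: (@approximable_dominated (fun n x => step_trig a n x.1 * step_trig b n x.2)
  _ (fun=> 1)).
- move=> n; apply/approximable_trigpoly/trigpolyM.
    exact: trigpoly_step_trig1.
  exact: trigpoly_step_trig2.
- exact: measurable_indic.
- exact/trigpoly_L2/trigpoly_cst.
- move=> n x; have /andP[a0 a1] := step_trig01 a n x.1.
  have /andP[b0 b1] := step_trig01 b n x.2.
  rewrite ger0_norm; last exact: mulr_ge0.
  by rewrite mulr_ile1.
- by move=> x; have /andP[? ?] := indic01 ([set x | x.1 < a] `&` [set x | x.2 < b]) x; rewrite ger0_norm.
- have h1 := torus_ae1 (@circle_ae_itv R); have h2 := torus_ae2 (@circle_ae_itv R).
  have n1 := torus_ae1 (circle_ae_neq a); have n2 := torus_ae2 (circle_ae_neq b).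
  apply: filterS2 (filterI h1 h2) (filterI n1 n2) => x [x1 x2] [y1 y2].
  rewrite (_ : \1_ _ x = (x.1 < a)%R%:R * (x.2 < b)%R%:R); last first.
    rewrite indicE -natrM mulnb; congr (nat_of_bool _)%:R.
    by apply/idP/andP => [/set_mem []//|[? ?]]; apply/mem_set.
  exact: (cvgM (step_trig_cvg x1 y1) (step_trig_cvg x2 y2)).
Qed.

(* The sets A such that phi^-1(A) /\ C has an approximable indicator form a
   Dynkin system. *)
Lemma approximable_preimage d (T : measurableType d) (G : set (set T))
    (phi : mR * mR -> T) (C : set (mR * mR)) :
  measurable_fun setT phi -> measurable C ->
  @measurable _ T = <<s G >> -> setI_closed G ->
  approximable (\1_C) ->
  (forall A, G A -> approximable (\1_(phi @^-1` A `&` C))) ->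
  forall A, measurable A -> approximable (\1_(phi @^-1` A `&` C)).
Proof.
move=> mphi mC mG GI CA GA A mA.
have mpC B : measurable B -> measurable (phi @^-1` B `&` C).
  by move=> mB; apply: measurableI => //; rewrite -[X in measurable X]setTI; exact: mphi.
apply: (@dynkin_induction _ T G (fun A => approximable (\1_(phi @^-1` A `&` C)))) => //.
- by rewrite preimage_setT setTI.
- move=> S mS SA; have := approximableB CA SA.
  congr approximable; apply/funext => x; rewrite !indicE !in_setI.
  have -> : (x \in phi @^-1` (~` S)) = ~~ (x \in phi @^-1` S).
    by rewrite preimage_setC in_setC.
  by case: (x \in C); case: (x \in phi @^-1` S); rewrite /= ?subrr ?subr0.
- move=> F mF tF FA.
  (* By disjointness at most one term is nonzero at x, so the partial sums are 0 or 1 and become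
     stationary. *)
  have key x : (\forall n \near \oo,
      \sum_(k <- iota 0 n) \1_(phi @^-1` F k `&` C) x = \1_(phi @^-1` (\bigcup_k F k) `&` C) x :> R)
      /\ forall n, 0 <= \sum_(k <- iota 0 n) (\1_(phi @^-1` F k `&` C) x : R) <= 1.
    have [Cx|Cx] := pselect (C x); last first.
      have z (B : set T) : \1_(phi @^-1` B `&` C) x = 0 :> R.
        by rewrite indicE memNset// => -[].
      split=> [|n]; first by apply: nearW => n; rewrite z big1.
      by rewrite big1 ?lexx ?ler01.
    have o (B : set T) : \1_(phi @^-1` B `&` C) x = (phi x \in B)%:R :> R.
      rewrite indicE in_setI (mem_set Cx) andbT.
      by have -> : (x \in phi @^-1` B) = (phi x \in B)
        by apply/idP/idP => /set_mem h; apply/mem_set.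
    have [[k0 _ Fk0]|nF] := pselect ((\bigcup_k F k) (phi x)); last first.
      have z k : \1_(phi @^-1` F k `&` C) x = 0 :> R.
        by rewrite o memNset// => h; apply: nF; exists k.
      split=> [|n]; last by rewrite big1 ?lexx ?ler01.
      by apply: nearW => n; rewrite o memNset// big1.
    have z k : \1_(phi @^-1` F k `&` C) x = (k == k0)%:R :> R.
      rewrite o; have -> // : (phi x \in F k) = (k == k0).
      apply/idP/eqP => [/set_mem Fk|->]; last exact/mem_set.
      by apply: (tF k k0) => //; exists (phi x).
    have s n : \sum_(k <- iota 0 n) \1_(phi @^-1` F k `&` C) x = (k0 < n)%N%:R :> R.
      under eq_bigr do rewrite z.
      elim: n => [|n IH]; first by rewrite big_nil.
      rewrite -addn1 iotaD big_cat/= IH big_seq1 add0n addn1 ltnS -natrD.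
      by case: (ltngtP k0 n) => /= h; rewrite ?addn0 ?add0n.
    split=> [|n]; last by rewrite s; case: (_ < _)%N; rewrite ?lexx ?ler01.
    exists k0.+1 => // n /= k0n; rewrite s k0n o mem_set//; by exists k0.
  apply: (@approximable_dominated (fun n x => \sum_(k <- iota 0 n) \1_(phi @^-1` F k `&` C) x)
    _ (fun=> 1)).
  + by move=> n; apply: approximable_sum.
  + by apply: measurable_indic; apply: mpC; exact: bigcupT_measurable.
  + exact/trigpoly_L2/trigpoly_cst.
  + by move=> n x; have [_ /(_ n)/andP[? ?]] := key x; rewrite ger0_norm.
  + by move=> x; have /andP[? ?] := indic01 (phi @^-1` (\bigcup_k F k) `&` C) x; rewrite ger0_norm.
  + by apply: nearW => x; apply: cvg_near_cst; have [] := key x.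
- by rewrite -mG.
Qed.

(** [approximable_preimage] is used three times: along the first coordinate with half-lines as
    generators, along the second one, and along the identity with rectangles as generators. *)
Lemma approximable_indic (A : set (mR * mR)) : measurable A -> approximable (\1_A).
Proof.
have mlt (c : R) : measurable ([set t : mR | t < c]).
  by rewrite (_ : [set t | t < c] = `]-oo, c[%classic)//; exact: measurable_itv.
have m1 : measurable_fun setT (fst : mR * mR -> mR) by exact: measurable_fst.
have m2 : measurable_fun setT (snd : mR * mR -> mR) by exact: measurable_snd.
have mp1 (B : set mR) : measurable B -> measurable (fst @^-1` B : set (mR * mR)).
  by move=> mB; rewrite -[X in measurable X]setTI; exact: m1.
have mp2 (B : set mR) : measurable B -> measurable (snd @^-1` B : set (mR * mR)).
  by move=> mB; rewrite -[X in measurable X]setTI; exact: m2.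
have GI : setI_closed (@RGenInftyO.G R).
  move=> _ _ [a ->] [b ->]; exists (Num.min a b).
  by apply/seteqP; split=> t /=; rewrite !in_itv/= lt_min;
    [by move=> [-> ->]|by move/andP].
have itvE (c : R) : `]-oo, c[%classic = [set t | t < c].
  by apply/seteqP; split=> t /=; rewrite in_itv.
have step1 b (B : set mR) : measurable B ->
    approximable (\1_(fst @^-1` B `&` [set x | x.2 < b])).
  apply: (approximable_preimage m1 (mp2 _ (mlt b)) (RGenInftyO.measurableE R) GI).
    (* Within the period the condition x_1 < 2 pi is void, so the half-plane agrees almost
       everywhere with a quadrant. *)
    apply: (approximable_ae (approximable_quadrant (2 * pi) b)).
      by apply: L2_indic; exact: (mp2 _ (mlt b)).
    apply: filterS (torus_ae1 (@circle_ae_itv R)) => x; rewrite in_itv/= => /andP[_ x1].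
    by rewrite !indicE in_setI (mem_set (A := [set x | x.1 < _]))// .
  by move=> _ [a ->]; rewrite itvE; exact: approximable_quadrant.
have step2 (B C : set mR) : measurable B -> measurable C ->
    approximable (\1_(B `*` C)).
  move=> mB mC; rewrite (_ : B `*` C = snd @^-1` C `&` fst @^-1` B); last first.
    by apply/seteqP; split=> x [].
  move: C mC.
  apply: (approximable_preimage m2 (mp1 _ mB) (RGenInftyO.measurableE R) GI).
    apply: (approximable_ae (step1 (2 * pi) B mB)).
      by apply: L2_indic; exact: (mp1 _ mB).
    apply: filterS (torus_ae2 (@circle_ae_itv R)) => x; rewrite in_itv/= => /andP[_ x1].
    by rewrite !indicE in_setI (mem_set (A := [set x | x.2 < _]))// andbT.
  by move=> _ [a ->]; rewrite itvE setIC; exact: step1.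
move=> mA.
have := @approximable_preimage _ (mR * mR)%type
  [set B `*` C | B in measurable & C in measurable] id setT (@measurable_id _ _ _)
  measurableT (@measurable_prod_measurableType _ _ mR mR) _ _ _ A mA.
rewrite preimage_id setIT; apply.
- move=> _ _ [A1 m1' [B1 m1'' <-]] [A2 m2' [B2 m2'' <-]].
  exists (A1 `&` A2); first exact: measurableI.
  exists (B1 `&` B2); first exact: measurableI.
  by rewrite setXI.
- have := approximable_trigpoly (trigpoly_cst (1 : R)).
  by congr approximable; apply/funext => x; rewrite indicE in_setT.
- by move=> _ [B mB [C mC <-]]; rewrite preimage_id setIT; exact: step2.
Qed.

Import HBSimple.
Import HBNNSimple.

Lemma approximable_ge0 g : (forall x, 0 <= g x) -> L2 g -> approximable g.
Proof.
move=> g0 gL; have mg := torus_L2_measurable gL.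
have mE : measurable_fun [set: mR * mR] (EFin \o g) by exact/measurable_EFinP.
have gE0 x : [set: mR * mR] x -> (0 <= (EFin \o g) x)%E by rewrite /= lee_fin.
pose s n : {nnsfun (mR * mR) >-> R} := nnsfun_approx measurableT mE n.
have sE n x : s n x = approx setT (EFin \o g) n x by rewrite /s nnsfun_approxE.
have s0 n x : 0 <= s n x by [].
have sg n x : s n x <= g x.
  by rewrite sE -lee_fin; apply: (@le_approx _ _ _ setT (EFin \o g)).
apply: (@approximable_dominated (fun n => s n) g g) => //.
- move=> n; rewrite (_ : (s n : R * R -> R) = fun x => \sum_(y \in range (s n)) y * \1_(s n @^-1` [set y]) x); last first.
    by apply/funext => x; exact: fimfunE.
  under [X in approximable X]eq_fun do rewrite fsbig_finite//.
  apply: approximable_sum => y; apply: approximableZ; apply: approximable_indic.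
  by rewrite -[X in measurable X]setTI; exact: measurable_funPT.
- by move=> n x; rewrite ger0_norm.
- by move=> x; rewrite ger0_norm.
- apply: nearW => x.
  rewrite (_ : (fun n => s n x) = (approx setT (EFin \o g))^~ x); last by apply/funext => n; exact: sE.
  by have := @cvg_approx _ _ _ setT (EFin \o g) x; apply => //; rewrite /= ltry.
Qed.

Theorem L2_approximable g : L2 g -> approximable g.
Proof.
move=> gL; have mg := torus_L2_measurable gL; have [_ g2] := (torus_L2P _).1 gL.
(* One statement covers the positive and the negative part: both are nonnegative with square at most
   g^2. *)
have pA h : measurable_fun setT (h : mR * mR -> R) ->
    (forall x, h x = Num.max (g x) 0 \/ h x = Num.max (- g x) 0) -> approximable h.
  move=> mh hE; apply: approximable_ge0.
    by move=> x; case: (hE x) => ->; rewrite le_max lexx orbT.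
  apply/torus_L2P; split => //; apply: (le_itg _ g2); first exact: measurable_funX.
  apply: nearW => x; rewrite ger0_norm ?sqr_ge0//.
  by case: (hE x) => ->; rewrite /Num.max; case: ifP => _; rewrite ?sqrrN ?expr0n ?sqr_ge0.
have := approximableB (pA (fun x => Num.max (g x) 0) _ _) (pA (fun x => Num.max (- g x) 0) _ _).
rewrite (_ : (fun x => _ - _) = g); last first.
  by apply/funext => x; rewrite /Num.max; case: ifP => ?; case: ifP => ?; lra.
apply.
- exact: measurable_maxr.
- by left.
- by apply: measurable_maxr => //; exact: measurableT_comp.
- by right.
Qed.

(** If p approximates g and m is large enough for P_m p = p, then g - P_m g = (g - p) - P_m (g - p),
    and I - P_m is a contraction. *)
Corollary fproj_cvg g (e : R) : L2 g -> 0 < e ->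
  exists M, forall m, M <= m -> \int[torus]_x (g x - fproj m g x) ^+ 2 <= e.
Proof.
move=> gL e0; have [_ /(_ e e0)[p tp gp]] := L2_approximable gL.
have [M pM] := fproj_trigpoly tp; exists M => m /pM pm.
apply: le_trans gp; have pL := trigpoly_L2 tp.
have := Rint_sqr_fproj_compl_le m (torus_L2B gL pL); apply: le_trans.
rewrite le_eqVlt; apply/orP; left; apply/eqP.
by apply: eq_Rint => x; rewrite fprojB// pm; congr (_ ^+ 2); lra.
Qed.

End Density.

(** * Weak derivatives *)

Section WeakDerivatives.
Context (R : realType).
Local Notation torus := (torus R).
Local Notation mR := (measurableTypeR R).
Local Notation A := ((2 * pi) ^+ 2 : R).
Implicit Types (f g h p q : R * R -> R) (k : int * int) (m : R).

Lemma wderivP j g : (exists h, is_wderiv j g h) -> is_wderiv j g (wderiv j g).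
Proof. by move=> /getPex. Qed.

Lemma is_wderiv_trigpoly j p : trigpoly p -> is_wderiv j p (partial j p).
Proof.
move=> tp; split; first exact/trigpoly_L2/trigpoly_partial.
by move=> psi; exact: Rint_parts.
Qed.

Lemma fcos_wderiv j g h k : L2 g -> is_wderiv j g h ->
  fcos h k = phase k (dir R j) * fsin g k.
Proof.
move=> gL [hL H]; apply: (mulfI (area_neq0 R)); rewrite -Rint_cos.
have tc := trigpoly_cos R k; have ts := trigpoly_sin R k.
have := H _ (trigpoly_smooth tc) (trigpoly_periodic tc).
rewrite partial_cos (_ : \int[torus]_x _ = - phase k (dir R j) * (A * fsin g k)); last first.
  rewrite -Rint_sin -RintZ; last exact: (torus_L2M gL (trigpoly_L2 ts)).
  by apply: eq_Rint => x; ring.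
by move=> /eqP; rewrite mulNr eqr_opp => /eqP <-; ring.
Qed.

Lemma fsin_wderiv j g h k : L2 g -> is_wderiv j g h ->
  fsin h k = - phase k (dir R j) * fcos g k.
Proof.
move=> gL [hL H]; apply: (mulfI (area_neq0 R)); rewrite -Rint_sin.
have tc := trigpoly_cos R k; have ts := trigpoly_sin R k.
have := H _ (trigpoly_smooth ts) (trigpoly_periodic ts).
rewrite partial_sin (_ : \int[torus]_x _ = phase k (dir R j) * (A * fcos g k)); last first.
  rewrite -Rint_cos -RintZ; last exact: (torus_L2M gL (trigpoly_L2 tc)).
  by apply: eq_Rint => x; ring.
by move=> E; apply: oppr_inj; rewrite -E; ring.
Qed.

(** All truncations of f - g vanish, and they converge to it in L2. *)
Lemma L2_Fourier_inj f g : L2 f -> L2 g ->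
  (forall k, fcos f k = fcos g k) -> (forall k, fsin f k = fsin g k) ->
  \forall x \ae torus, f x = g x.
Proof.
move=> fL gL fgc fgs.
have dL := torus_L2B fL gL.
have d0 m : fproj m (fun x => f x - g x) = fun=> 0.
  rewrite fprojB// !fprojE; apply/funext => x.
  by apply/eqP; rewrite subr_eq0; apply/eqP; apply: eq_bigr => k _; rewrite fgc fgs.
have d20 : \int[torus]_x (f x - g x) ^+ 2 = 0.
  apply/eqP; rewrite eq_le Rint_sqr_ge0 andbT; apply/ler_addgt0Pr => e e0; rewrite add0r.
  have [M /(_ M (lexx M))] := fproj_cvg dL e0; rewrite d0.
  by under eq_Rintegral do rewrite subr0.
apply: filterS (torus_Rint_sqr_eq0 dL d20) => x dx.
by apply/eqP; rewrite -subr_eq0; apply/eqP.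
Qed.

(** Up to a null set, this lets the representative chosen by [wderiv] be replaced by any weak
    derivative that can be computed. *)
Lemma is_wderiv_inj j g h1 h2 : L2 g -> is_wderiv j g h1 -> is_wderiv j g h2 ->
  \forall x \ae torus, h1 x = h2 x.
Proof.
move=> gL d1 d2; apply: L2_Fourier_inj; [exact: d1.1|exact: d2.1| |] => k.
  by rewrite (fcos_wderiv k gL d1) (fcos_wderiv k gL d2).
by rewrite (fsin_wderiv k gL d1) (fsin_wderiv k gL d2).
Qed.

Lemma wderiv_trigpoly j p : trigpoly p ->
  \forall x \ae torus, wderiv j p x = partial j p x.
Proof.
move=> tp; have d := is_wderiv_trigpoly j tp.
by apply: (is_wderiv_inj (trigpoly_L2 tp) _ d); apply: wderivP; exists (partial j p).
Qed.

Lemma smooth_L2 (psi : R * R -> R) : smooth psi -> L2 psi.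
Proof. by move=> s; apply: continuous_L2; have [] := s [::]. Qed.

Lemma smooth_partial_L2 j (psi : R * R -> R) : smooth psi -> L2 (partial j psi).
Proof. by move=> s; apply: continuous_L2; have [] := s [:: j]. Qed.

Lemma is_wderiv_ae j f g h : L2 f -> L2 g -> (\forall x \ae torus, f x = g x) ->
  is_wderiv j f h -> is_wderiv j g h.
Proof.
move=> fL gL fg [hL H]; split => // psi spsi ppsi; rewrite -H//.
have mf := torus_L2_measurable fL; have mg := torus_L2_measurable gL.
have mp := torus_L2_measurable (smooth_partial_L2 j spsi).
apply: (@Rint_ae _ _ _ torus); [exact: measurable_funM|exact: measurable_funM|].
by apply: filterS fg => x ->.
Qed.

(** The inner [wderiv] is only almost everywhere a trigonometric polynomial, so the second
    derivative is computed after replacing it through [is_wderiv_ae]. *)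
Lemma wderiv2_trigpoly j p : trigpoly p ->
  \forall x \ae torus, wderiv j (wderiv j p) x = partial j (partial j p) x.
Proof.
move=> tp; have t1 := trigpoly_partial j tp; have ae1 := wderiv_trigpoly j tp.
have [wL _] : is_wderiv j p (wderiv j p).
  by apply: wderivP; exists (partial j p); exact: is_wderiv_trigpoly.
have d : is_wderiv j (wderiv j p) (partial j (partial j p)).
  apply: is_wderiv_ae (is_wderiv_trigpoly j t1) => //; first exact: trigpoly_L2.
  by apply: filterS ae1 => x ->.
by apply: (is_wderiv_inj wL _ d); apply: wderivP; exists (partial j (partial j p)).
Qed.

Lemma partial_fprojE m j g : partial j (fproj m g) = fun x =>
  \sum_(k <- modes m) phase k (dir R j) *
    (fsin g k * cos (phase k x) - fcos g k * sin (phase k x)).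
Proof.
rewrite fprojE partial_sum; last first.
  move=> k; apply: trigpolyD; apply: trigpolyZ; [exact: trigpoly_cos|exact: trigpoly_sin].
apply/funext => x; apply: eq_bigr => k _.
have tc := trigpoly_cos R k; have ts := trigpoly_sin R k.
rewrite partialD; last 2 first.
- by apply: trigpoly_derivable; exact: trigpolyZ.
- by apply: trigpoly_derivable; exact: trigpolyZ.
rewrite !partialZ; [|exact: trigpoly_derivable|exact: trigpoly_derivable].
by rewrite partial_cos partial_sin; ring.
Qed.

(** Equality holds at every point: both sides are finite sums with the same coefficients. *)
Lemma partial_fproj m j g h : L2 g -> is_wderiv j g h ->
  partial j (fproj m g) = fproj m h.
Proof.
move=> gL d; rewrite partial_fprojE fprojE; apply/funext => x.
by apply: eq_bigr => k _; rewrite (fcos_wderiv k gL d) (fsin_wderiv k gL d); ring.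
Qed.

Lemma Rint_fproj_cvg f g : L2 f -> L2 g ->
  \int[torus]_x (f x * fproj n%:R g x) @[n --> \oo] --> \int[torus]_x (f x * g x).
Proof.
move=> fL gL; apply/cvgrPdist_le => e e0.
set F := Num.sqrt (\int[torus]_x f x ^+ 2).
have F0 : 0 <= F := sqrtr_ge0 _.
(* The norm F of f may be 0, hence the F + 1. *)
have e1 : 0 < (e / (F + 1)) ^+ 2 by rewrite exprn_gt0// divr_gt0// ltr_wpDl.
have [M HM] := fproj_cvg gL e1.
near=> n.
have pL := L2_fproj n%:R g; have dL := torus_L2B gL pL.
rewrite -RintB; [|exact: (torus_L2M fL gL)|exact: (torus_L2M fL pL)].
rewrite (_ : \int[torus]_x _ = \int[torus]_x (f x * (g x - fproj n%:R g x))); last first.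
  by apply: eq_Rint => x; rewrite mulrBr.
apply: le_trans (torus_CauchySchwarz fL dL) _; rewrite -/F.
have h : Num.sqrt (\int[torus]_x (g x - fproj n%:R g x) ^+ 2) <= e / (F + 1).
  have e2 : 0 <= e / (F + 1) by rewrite divr_ge0// ?addr_ge0// ltW.
  rewrite -[leRHS]ger0_norm// -sqrtr_sqr ler_wsqrtr//; apply: HM.
  by near: n; exact: nbhs_infty_ger.
apply: le_trans (ler_wpM2l F0 h) _.
rewrite mulrCA ger_pMr// ler_pdivrMr ?mul1r ?lerDl//; lra.
Unshelve. all: by end_near. Qed.

Lemma cvgr_sum (I : Type) (r : seq I) (u : I -> nat -> R) (l : I -> R) :
  (forall i, u i n @[n --> \oo] --> l i) ->
  \sum_(i <- r) u i n @[n --> \oo] --> \sum_(i <- r) l i.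
Proof. by move=> ul; apply: cvg_big => // ; exact: add_continuous. Qed.

(** The definition admits only smooth test functions. Truncations of h are admissible, their
    derivatives are the truncations of h', and both sides pass to the limit. *)
Lemma Rint_wderivC j g g' h h' : L2 g -> is_wderiv j g g' -> L2 h -> is_wderiv j h h' ->
  \int[torus]_x (g x * h' x) = - \int[torus]_x (g' x * h x).
Proof.
move=> gL dg hL dh.
have c1 := Rint_fproj_cvg gL dh.1; have c2 := cvgN (Rint_fproj_cvg dg.1 hL).
apply: (cvg_unique _ c1); first exact: Rhausdorff.
suff -> : (fun n => \int[torus]_x (g x * fproj n%:R h' x)) =
    (fun n => - \int[torus]_x (g' x * fproj n%:R h x)) by exact: c2.
apply/funext => n; have tp := trigpoly_fproj n%:R h.
rewrite -(partial_fproj n%:R hL dh).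
exact: (dg.2 _ (trigpoly_smooth tp) (trigpoly_periodic tp)).
Qed.

Lemma L2_mul_trigpoly f p : L2 f -> trigpoly p -> L2 (fun x => f x * p x).
Proof.
move=> fL tp; have [M pM] := trigpoly_bounded tp.
rewrite (_ : (fun x => f x * p x) = (fun x => p x * f x)); last first.
  by apply/funext => x; rewrite mulrC.
apply: (@L2_mul_bounded _ _ _ torus M _ _ (trigpoly_measurable tp) fL).
exact: nearW.
Qed.

(** [div_free] is tested with the product of p and a truncation of g. The limit is taken against a_j
    p and a_j times the j-th partial of p, which are square-integrable because p and its partials
    are bounded. *)
Lemma div_free_skew (a : vfield R) g (g' : 'I_2 -> R * R -> R) p :
  vL2 a -> div_free a -> L2 g -> (forall j, is_wderiv j g (g' j)) -> trigpoly p ->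
  \sum_j \int[torus]_x (a j x * g' j x * p x) =
  - \sum_j \int[torus]_x (a j x * g x * partial j p x).
Proof.
move=> aL diva gL dg tp.
have apL j : L2 (fun x => a j x * p x) by exact: L2_mul_trigpoly.
have adL j : L2 (fun x => a j x * partial j p x).
  by apply: L2_mul_trigpoly => //; exact: trigpoly_partial.
apply/eqP; rewrite -addr_eq0 -big_split/=; apply/eqP.
have c : \sum_j (\int[torus]_x (a j x * p x * fproj n%:R (g' j) x) +
    \int[torus]_x (a j x * partial j p x * fproj n%:R g x)) @[n --> \oo] -->
    \sum_j (\int[torus]_x (a j x * p x * g' j x) +
    \int[torus]_x (a j x * partial j p x * g x)).
  apply: cvgr_sum => j; apply: cvgD; apply: Rint_fproj_cvg => //; exact: (dg j).1.
have z : (fun n : nat => \sum_j (\int[torus]_x (a j x * p x * fproj n%:R (g' j) x) +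
    \int[torus]_x (a j x * partial j p x * fproj n%:R g x))) = fun=> 0.
  apply/funext => n; have tn := trigpoly_fproj n%:R g.
  have tnp := trigpolyM tn tp.
  rewrite -[RHS](diva _ (trigpoly_smooth tnp) (trigpoly_periodic tnp)).
  apply: eq_bigr => j _; rewrite -RintD.
  - apply: eq_Rint => x; rewrite partialM; [|exact: trigpoly_derivable|exact: trigpoly_derivable].
    by rewrite -(partial_fproj n%:R gL (dg j)); ring.
  - by apply: (torus_L2M (apL j)); exact: L2_fproj.
  - by apply: (torus_L2M (adL j)); exact: L2_fproj.
rewrite z in c; have c0 : (fun=> 0 : R) @ \oo --> (0 : R) by exact: cvg_cst.
rewrite -[RHS](cvg_unique (@Rhausdorff R) c c0).
apply: eq_bigr => j _; congr (_ + _); apply: eq_Rint => x; ring.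
Qed.

Lemma cvg_eq_opp (u v : nat -> R) (l : R) :
  u n @[n --> \oo] --> l -> v n @[n --> \oo] --> l ->
  (forall n, u n = - v n) -> l = 0.
Proof.
move=> ul vl uv; have ll : l = - l.
  apply: (cvg_unique (@Rhausdorff R) ul).
  by rewrite (_ : u = (fun n => - v n)); [exact: cvgN|exact/funext].
lra.
Qed.

(** [div_free_skew] with p a truncation of g equates one sequence to the opposite of another, and
    both have the integral in question as limit. The bound on a keeps a_j g and a_j g'_j in L2. *)
Lemma div_free_antisym (a : vfield R) M g (g' : 'I_2 -> R * R -> R) :
  vL2 a -> div_free a -> (forall j, \forall x \ae torus, `|a j x| <= M) ->
  L2 g -> (forall j, is_wderiv j g (g' j)) ->
  \sum_j \int[torus]_x (a j x * g' j x * g x) = 0.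
Proof.
move=> aL diva aM gL dg.
have agL j : L2 (fun x => a j x * g x).
  exact: (@L2_mul_bounded _ _ _ torus M _ _ (torus_L2_measurable (aL j)) gL (aM j)).
have agL' j : L2 (fun x => a j x * g' j x).
  exact: (@L2_mul_bounded _ _ _ torus M _ _ (torus_L2_measurable (aL j)) (dg j).1 (aM j)).
apply: (@cvg_eq_opp (fun n => \sum_j \int[torus]_x (a j x * g' j x * fproj n%:R g x))
    (fun n => \sum_j \int[torus]_x (a j x * g x * fproj n%:R (g' j) x))).
- by apply: cvgr_sum => j; exact: Rint_fproj_cvg.
- rewrite (_ : \sum_j _ = \sum_j \int[torus]_x (a j x * g x * g' j x)); last first.
    by apply: eq_bigr => j _; apply: eq_Rint => x; ring.
  by apply: cvgr_sum => j; apply: Rint_fproj_cvg => //; exact: (dg j).1.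
- move=> n.
  transitivity (- \sum_j \int[torus]_x (a j x * g x * partial j (fproj n%:R g) x)).
    exact: (div_free_skew aL diva gL dg (trigpoly_fproj n%:R g)).
  congr (- _); apply: eq_bigr => j _; by rewrite (partial_fproj n%:R gL (dg j)).
Qed.

Lemma Rint_sqr_grad_fproj M g (g' : 'I_2 -> R * R -> R) :
  L2 g -> (forall j, is_wderiv j g (g' j)) ->
  \sum_j \int[torus]_x fproj M (g' j) x ^+ 2 =
  A * \sum_(k <- modes M) wavenum_norm R k ^+ 2 * (fcos g k ^+ 2 + fsin g k ^+ 2).
Proof.
move=> gL dg.
under eq_bigr => j _ do rewrite (Rint_sqr_fproj M (dg j).1).
rewrite -mulr_sumr exchange_big/=; congr (_ * _); apply: eq_bigr => k _.
rewrite wavenum_normE mulr_suml; apply: eq_bigr => j _.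
by rewrite (fcos_wderiv k gL (dg j)) (fsin_wderiv k gL (dg j)); ring.
Qed.

(** Bernstein's inequality: the gradient multiplies the modes by wavenumbers at most m. *)
Lemma grad_fproj_le m g (g' : 'I_2 -> R * R -> R) : 0 <= m ->
  L2 g -> (forall j, is_wderiv j g (g' j)) ->
  \sum_j \int[torus]_x fproj m (g' j) x ^+ 2 <= m ^+ 2 * \int[torus]_x fproj m g x ^+ 2.
Proof.
move=> m0 gL dg; rewrite (Rint_sqr_grad_fproj m gL dg) Rint_sqr_fproj//.
rewrite mulrCA ler_wpM2l ?sqr_ge0// mulr_sumr.
rewrite big_seq [leRHS]big_seq; apply: ler_sum => k; rewrite mem_modes => km.
by rewrite ler_wpM2r ?addr_ge0 ?sqr_ge0// lerXn2r// nnegrE sqrtr_ge0.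
Qed.

Lemma perm_modes m M : m <= M ->
  perm_eq (modes m) [seq k <- modes M | wavenum_norm R k <= m].
Proof.
move=> mM; apply: uniq_perm; [exact: modes_uniq|by rewrite filter_uniq// modes_uniq|].
move=> k; rewrite mem_filter !mem_modes; apply/idP/andP => [km|[]//].
by split => //; exact: le_trans mM.
Qed.

(** The number c separates the cutoff from the smallest wavenumber beyond it: m = 0 and c = 1 give
    the Poincaré inequality for mean-free functions, m = c = N the bound on the modes above N. *)
Lemma Poincare_high_modes m (c : R) g (g' : 'I_2 -> R * R -> R) : 0 <= c ->
  (forall k, m < wavenum_norm R k -> c <= wavenum_norm R k) ->
  L2 g -> (forall j, is_wderiv j g (g' j)) ->
  c ^+ 2 * \int[torus]_x (g x - fproj m g x) ^+ 2 <= \sum_j \int[torus]_x g' j x ^+ 2.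
Proof.
move=> c0 cP gL dg; apply/ler_addgt0Pr => e e0.
have c1 : 0 < c ^+ 2 + 1 by have := sqr_ge0 c; lra.
have [M0 HM] := fproj_cvg gL (divr_gt0 e0 c1).
pose M := Num.max M0 m; have {}HM := HM M; rewrite le_max lexx in HM.
have mM : m <= M by rewrite le_max lexx orbT.
have {}HM := HM isT; rewrite ler_pdivlMr// in HM.
have g2 := Rint_sqr_fproj_compl M gL.
rewrite Rint_sqr_fproj_compl//.
(* Between the cutoffs m and M only finitely many modes remain, each of wavenumber at least c; the
   tail above M costs at most e. *)
have key : c ^+ 2 * (\int[torus]_x fproj M g x ^+ 2 - \int[torus]_x fproj m g x ^+ 2)
    <= \sum_j \int[torus]_x fproj M (g' j) x ^+ 2.
  rewrite (Rint_sqr_grad_fproj M gL dg) !Rint_sqr_fproj// -mulrBr mulrCA.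
  rewrite ler_wpM2l ?sqr_ge0// (perm_big _ (perm_modes mM)) big_filter/=.
  set S := (X in X - _); rewrite [S](bigID (fun k => wavenum_norm R k <= m))/= {}/S.
  rewrite [X in _ * X]addrC addKr.
  rewrite [leRHS](bigID (fun k => wavenum_norm R k <= m))/=.
  rewrite -[leLHS]add0r lerD//.
    by apply: sumr_ge0 => k _; rewrite mulr_ge0 ?addr_ge0 ?sqr_ge0.
  rewrite mulr_sumr; apply: ler_sum => k; rewrite -ltNge => mk.
  by rewrite ler_wpM2r ?addr_ge0 ?sqr_ge0// lerXn2r ?nnegrE ?sqrtr_ge0// cP.
have bes : \sum_j \int[torus]_x fproj M (g' j) x ^+ 2 <= \sum_j \int[torus]_x g' j x ^+ 2.
  by apply: ler_sum => j _; apply: Bessel; exact: (dg j).1.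
have := Rint_sqr_ge0 torus (fun x => g x - fproj M g x).
move: key bes g2 HM; nra.
Qed.

End WeakDerivatives.

(** * Elementary inequalities *)

(** Lagrange's identity. *)
Lemma sum_CauchySchwarz (R : realFieldType) (I : finType) (a b : I -> R) :
  (\sum_i a i * b i) ^+ 2 <= (\sum_i a i ^+ 2) * (\sum_i b i ^+ 2).
Proof.
have E : \sum_i \sum_j (a i * b j - a j * b i) ^+ 2 =
    2 * ((\sum_i a i ^+ 2) * (\sum_i b i ^+ 2) - (\sum_i a i * b i) ^+ 2).
  transitivity (\sum_i \sum_j (a i ^+ 2 * b j ^+ 2 + a j ^+ 2 * b i ^+ 2 -
      2 * ((a i * b i) * (a j * b j)))).
    by apply: eq_bigr => i _; apply: eq_bigr => j _; ring.
  under eq_bigr => i _ do rewrite sumrB big_split/=.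
  rewrite sumrB big_split/=.
  rewrite [X in _ + X - _]exchange_big/= mulrBr; congr (_ - _).
    by rewrite mulr_natl mulr2n big_distrlr.
  under eq_bigr => i _ do rewrite -mulr_sumr.
  by rewrite -mulr_sumr expr2 big_distrlr/=; congr (_ * _); apply: eq_bigr => i _; rewrite mulr_sumr.
have : 0 <= \sum_i \sum_j (a i * b j - a j * b i) ^+ 2.
  by apply: sumr_ge0 => i _; apply: sumr_ge0 => j _; exact: sqr_ge0.
rewrite E; lra.
Qed.

(** The left side is a bilinear form in (s, t) and (a, b) with matrix rows (5/4, 1/4) and (1/4, 1).
    Its squared norm is at most 2, as 3/8 (a - 3/2 b)^2 + 3/32 b^2 >= 0 certifies. *)
Lemma quadratic_form_bound (R : realFieldType) (s t a b : R) :
  (5/4 * s * a + t * b + 4^-1 * t * a + 4^-1 * s * b) ^+ 2 <=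
  2 * ((s ^+ 2 + t ^+ 2) * (a ^+ 2 + b ^+ 2)).
Proof.
have cs (x y z w : R) : (x * z + y * w) ^+ 2 <= (x ^+ 2 + y ^+ 2) * (z ^+ 2 + w ^+ 2).
  by have := sqr_ge0 (x * w - y * z); nra.
have := cs s t (5/4 * a + 4^-1 * b) (b + 4^-1 * a).
have h : (5/4 * a + 4^-1 * b) ^+ 2 + (b + 4^-1 * a) ^+ 2 <= 2 * (a ^+ 2 + b ^+ 2).
  have := sqr_ge0 (a - 3/2 * b); have := sqr_ge0 b; lra.
have st : 0 <= s ^+ 2 + t ^+ 2 by rewrite addr_ge0 ?sqr_ge0.
have := ler_wpM2l st h.
rewrite (_ : s * (5/4 * a + 4^-1 * b) + t * (b + 4^-1 * a) =
  5/4 * s * a + t * b + 4^-1 * t * a + 4^-1 * s * b); [lra|ring].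
Qed.

(* With [s = m sqrt nu], [t = sqrt mu], [a = sqrt nu W] and [b = sqrt mu p], the
   upper bound on [X] is a bilinear form in [(s, t)] and [(a, b)], and [P] is
   bounded below by a quadratic form in [(a, b)]. *)
Lemma sensitivity_algebra (R : rcfType) (nu mu m N W p n X M c P : R) :
  0 < nu -> 0 < mu -> 0 < m -> 0 < N -> 0 <= W -> 0 <= p -> 0 <= n -> 0 <= X ->
  0 <= M -> 16 * M ^+ 2 <= mu * nu -> 4 * M <= nu * N ->
  8 * c <= nu * N -> 32 * c ^+ 2 <= mu * nu -> m <= N ->
  N ^+ 2 * (n ^+ 2 - p ^+ 2) <= W ^+ 2 ->
  nu * W ^+ 2 + mu * p ^+ 2 - c * W * n <= P ->
  X ^+ 2 <= nu * (W * (m * X)) + mu * (p * X) + M * W * X + M * n * (m * X) ->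
  X ^+ 2 / (nu * m ^+ 2 + mu) <= 3 * P.
Proof.
move=> nu0 mu0 m0 N0 W0 p0 n0 X0 M0 M1 M2 c1 c2 mN hn hP hX.
have d0 : 0 < nu * m ^+ 2 + mu by rewrite addr_gt0// mulr_gt0// exprn_gt0.
rewrite ler_pdivrMr//.
set r := Num.sqrt nu; set t := Num.sqrt mu.
have r0 : 0 < r by rewrite sqrtr_gt0.
have t0 : 0 < t by rewrite sqrtr_gt0.
have rE : nu = r ^+ 2 by rewrite sqr_sqrtr// ltW.
have tE : mu = t ^+ 2 by rewrite sqr_sqrtr// ltW.
have le_sq (x y : R) : 0 <= y -> x ^+ 2 <= y ^+ 2 -> x <= y.
  by move=> y0 xy; rewrite leNgt; apply/negP => yx; nra.
(* N^2 n^2 <= N^2 p^2 + W^2 <= (N p + W)^2. *)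
have nW : N * n <= N * p + W.
  apply: le_sq; first by rewrite addr_ge0// mulr_ge0// ltW.
  have := mulr_ge0 (mulr_ge0 (ltW N0) p0) W0; move: hn; nra.
have hM : 4 * M <= t * r.
  apply: le_sq; first by rewrite mulr_ge0// ltW.
  by rewrite !exprMn -rE -tE; move: M1; lra.
(* The factor 32 is relaxed to 25 to have a rational root. *)
have hc : 5 * c <= t * r.
  apply: le_sq; first by rewrite mulr_ge0// ltW.
  by rewrite !exprMn -rE -tE; have := sqr_ge0 c; move: c2; lra.
pose a := r * W; pose b := t * p.
have a0 : 0 <= a by rewrite mulr_ge0// ltW.
have b0 : 0 <= b by rewrite mulr_ge0// ltW.
have hMn : M * n <= 4^-1 * (t * r * p + r ^+ 2 * W).
  have h1 : M * (N * n) <= M * (N * p + W) by rewrite ler_wpM2l.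
  have h2 : 4 * (M * N * p) <= t * r * (N * p).
    by rewrite -(mulrA M) mulrA ler_wpM2r// mulr_ge0// ltW.
  have h3 : 4 * M * W <= nu * N * W by rewrite ler_wpM2r.
  rewrite -(ler_pM2l N0); rewrite rE in h3; lra.
(* The viscous term gives 1 of the coefficient 5/4; the other 1/4 comes from M n m through [hMn]. *)
have hX2 : X <= 5/4 * (r * m) * a + t * b + 4^-1 * t * a + 4^-1 * (r * m) * b.
  have [X00|X00] := ltP 0 X; last first.
    have -> : X = 0 by apply/eqP; rewrite eq_le X00.
    have rm0 : 0 <= r * m by rewrite mulr_ge0// ltW.
    have := mulr_ge0 rm0 a0; have := mulr_ge0 (ltW t0) b0.
    have := mulr_ge0 (ltW t0) a0; have := mulr_ge0 rm0 b0; lra.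
  rewrite -(ler_pM2r X00) -expr2; apply: (le_trans hX).
  have h1 : M * W <= 4^-1 * (t * r * W).
    by have := ler_wpM2r W0 hM; lra.
  have h2 : M * W * X <= 4^-1 * (t * r * W) * X by rewrite ler_wpM2r.
  have h3 : M * n * (m * X) <= 4^-1 * (t * r * p + r ^+ 2 * W) * (m * X).
    by rewrite ler_wpM2r// mulr_ge0// ltW.
  rewrite rE tE /a /b; lra.
have hX3 : X ^+ 2 <= 2 * ((nu * m ^+ 2 + mu) * (a ^+ 2 + b ^+ 2)).
  have := quadratic_form_bound (r * m) t a b; rewrite exprMn -rE -tE; apply: le_trans.
  rewrite lerXn2r// nnegrE; exact: le_trans hX2.
(* c W n <= a b / 5 + a^2 / 8 and 2 a b <= a^2 + b^2 leave the coefficients 31/40 and 9/10, both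
   above 2/3. *)
have hP2 : 2/3 * (a ^+ 2 + b ^+ 2) <= P.
  apply: le_trans hP; rewrite rE tE.
  (* The sign of c is not assumed; for c <= 0 the cross term only helps. *)
  have [c0|c0] := leP c 0.
    have h : c * W * n <= 0 by rewrite -mulrA mulr_le0_ge0// mulr_ge0.
    by rewrite /a /b !exprMn; have := sqr_ge0 (r * W); have := sqr_ge0 (t * p); rewrite !exprMn; lra.
  have h1 : c * (N * n) <= c * (N * p + W) by rewrite ler_wpM2l// ltW.
  have h2 : 5 * c * (N * p) <= t * r * (N * p).
    by rewrite ler_wpM2r// mulr_ge0// ltW.
  have h3 : 8 * c * W <= r ^+ 2 * N * W by rewrite ler_wpM2r// -rE.
  have hcn : c * n <= 5^-1 * (t * r * p) + 8^-1 * (r ^+ 2 * W).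
    by rewrite -(ler_pM2l N0); lra.
  have h4 : W * (c * n) <= W * (5^-1 * (t * r * p) + 8^-1 * (r ^+ 2 * W)) by rewrite ler_wpM2l.
  have : 0 <= (a - b) ^+ 2 by exact: sqr_ge0.
  have := sqr_ge0 a; have := sqr_ge0 b; rewrite /a /b; lra.
have := ler_wpM2l (ltW d0) hP2; lra.
Qed.

(** * The Stokes operator and its truncations *)

Section Estimates.
Context (R : realType).
Local Notation torus := (torus R).
Local Notation mR := (measurableTypeR R).
Implicit Types (f g h p q : R * R -> R) (k : int * int) (m : R) (u v w phi : vfield R).

Lemma sum_ord2 (F : 'I_2 -> R) : \sum_i F i = F ord0 + F (lift ord0 ord0).
Proof. by rewrite !big_ord_recl big_ord0 addr0. Qed.

(** The argument is a gradient instead of a field, so as to cover the chosen weak derivatives as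
    well as the classical partials of a test field. *)
Definition dirichlet (G : 'I_2 -> 'I_2 -> R * R -> R) : R :=
  \sum_i \sum_j \int[torus]_x G i j x ^+ 2.

Lemma dirichlet_ge0 G : 0 <= dirichlet G.
Proof. by apply: sumr_ge0 => i _; apply: sumr_ge0 => j _; exact: Rint_sqr_ge0. Qed.

Lemma vdot_self_ge0 u : 0 <= vdot u u.
Proof.
apply: sumr_ge0 => i _.
by under eq_Rintegral do rewrite -expr2; exact: Rint_sqr_ge0.
Qed.

Lemma vdot_sqr u : vdot u u = \sum_i \int[torus]_x u i x ^+ 2.
Proof. by apply: eq_bigr => i _; apply: eq_Rint => x; rewrite expr2. Qed.

Lemma norm2_sqr u : norm2 u ^+ 2 = vdot u u.
Proof. by rewrite sqr_sqrtr// vdot_self_ge0. Qed.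

Lemma normV_sqr u : normV u ^+ 2 = dirichlet (fun i j => wderiv j (u i)).
Proof. by rewrite sqr_sqrtr// dirichlet_ge0. Qed.

Lemma normVE u : normV u = Num.sqrt (dirichlet (fun i j => wderiv j (u i))).
Proof. by []. Qed.

Lemma sum_CauchySchwarz2 (a b : 'I_2 -> 'I_2 -> R) :
  (\sum_i \sum_j a i j * b i j) ^+ 2 <=
  (\sum_i \sum_j a i j ^+ 2) * (\sum_i \sum_j b i j ^+ 2).
Proof. by rewrite !pair_big/=; exact: sum_CauchySchwarz. Qed.

(** Summing over i and j under a single integral gives Frobenius norms and the constant 1. The
    majorant h will be |w|^4 or M^2 times the square of a field. *)
Lemma matrix_CauchySchwarz (a b : 'I_2 -> 'I_2 -> R * R -> R) h :
  (forall i j, L2 (a i j)) ->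
  (forall i j, itg torus (fun x => a i j x * b i j x)) ->
  itg torus h ->
  (\forall x \ae torus, \sum_i \sum_j b i j x ^+ 2 <= h x) ->
  `|\sum_i \sum_j \int[torus]_x (a i j x * b i j x)| <=
  Num.sqrt (dirichlet a) * Num.sqrt (\int[torus]_x h x).
Proof.
move=> aL abi hi bh.
have a2 i j : itg torus (fun x => a i j x ^+ 2) by case/torus_L2P: (aL i j).
have -> : dirichlet a = \int[torus]_x \sum_i \sum_j a i j x ^+ 2.
  rewrite Rint_sum; last by move=> i; exact: itg_sum.
  by apply: eq_bigr => i _; rewrite Rint_sum.
have si : itg torus (fun x => \sum_i \sum_j a i j x * b i j x).
  by apply: itg_sum => i; exact: itg_sum.
have -> : \sum_i \sum_j \int[torus]_x (a i j x * b i j x) =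
    \int[torus]_x \sum_i \sum_j a i j x * b i j x.
  rewrite Rint_sum; last by move=> i; exact: itg_sum.
  by apply: eq_bigr => i _; rewrite Rint_sum.
apply: (proj2 (@Rint_CauchySchwarz _ _ _ torus _ _ _ (itg_measurable si) _ hi _)).
  by apply: itg_sum => i; exact: itg_sum.
apply: filterS bh => x bh.
have b0 : 0 <= \sum_i \sum_j b i j x ^+ 2.
  by apply: sumr_ge0 => i _; apply: sumr_ge0 => j _; exact: sqr_ge0.
have A0 : 0 <= \sum_i \sum_j a i j x ^+ 2.
  by apply: sumr_ge0 => i _; apply: sumr_ge0 => j _; exact: sqr_ge0.
split => //; first exact: le_trans bh.
by apply: le_trans (sum_CauchySchwarz2 (fun i j => a i j x) (fun i j => b i j x)) _;
  rewrite ler_wpM2l.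
Qed.

Lemma vdot_CauchySchwarz u v : vL2 u -> vL2 v -> `|vdot u v| <= norm2 u * norm2 v.
Proof.
move=> uL vL.
have u2 i : itg torus (fun x => u i x ^+ 2) by case/torus_L2P: (uL i).
have v2 i : itg torus (fun x => v i x ^+ 2) by case/torus_L2P: (vL i).
have uv i : itg torus (fun x => u i x * v i x) := torus_L2M (uL i) (vL i).
rewrite /norm2 !vdot_sqr /vdot -!Rint_sum//.
apply: (proj2 (@Rint_CauchySchwarz _ _ _ torus _ _ _ _ _ _ _)).
- by apply: itg_measurable; exact: itg_sum.
- exact: itg_sum.
- exact: itg_sum.
apply: nearW => x; split; [by apply: sumr_ge0 => i _; exact: sqr_ge0|
  by apply: sumr_ge0 => i _; exact: sqr_ge0|].
exact: (sum_CauchySchwarz (fun i => u i x) (fun i => v i x)).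
Qed.

Lemma vdotC u v : vdot u v = vdot v u.
Proof. by apply: eq_bigr => i _; apply: eq_Rint => x; rewrite mulrC. Qed.

Lemma vdotDl u v w : vL2 u -> vL2 v -> vL2 w ->
  vdot (fun i x => u i x + v i x) w = vdot u w + vdot v w.
Proof.
move=> uL vL wL; rewrite -big_split/=; apply: eq_bigr => i _.
rewrite -RintD; [|exact: torus_L2M|exact: torus_L2M].
by apply: eq_Rint => x; rewrite mulrDl.
Qed.

Lemma vdotZl a u w : vL2 u -> vL2 w ->
  vdot (fun i x => a * u i x) w = a * vdot u w.
Proof.
move=> uL wL; rewrite mulr_sumr; apply: eq_bigr => i _.
rewrite -RintZ; last exact: torus_L2M.
by apply: eq_Rint => x; rewrite mulrA.
Qed.

Lemma vdotNl u w : vL2 u -> vL2 w -> vdot (fun i x => - u i x) w = - vdot u w.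
Proof.
move=> uL wL; rewrite -mulN1r -vdotZl//; apply: eq_bigr => i _.
by apply: eq_Rint => x; rewrite mulN1r.
Qed.

Lemma eq_vdotl u v w : vL2 u -> vL2 v -> vL2 w -> veq u v -> vdot u w = vdot v w.
Proof.
move=> uL vL wL uv; apply: eq_bigr => i _; apply: (@Rint_ae _ _ _ torus).
- by apply: measurable_funM; exact: torus_L2_measurable.
- by apply: measurable_funM; exact: torus_L2_measurable.
- by apply: filterS (uv i) => x ->.
Qed.

(** Test fields in H do not see the Leray projection. *)
Lemma vdot_leray a b phi : is_leray a b -> spaceH phi -> vdot b phi = vdot a phi.
Proof.
move=> [aL [bL _ _] H] pH; have [pL _ _] := pH.
have := H _ pH; rewrite vdotDl//; last by move=> i; exact: torus_L2N.
by rewrite vdotNl// => /eqP; rewrite subr_eq0 => /eqP.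
Qed.

(** * The weak Laplacian in Fourier variables *)

Section Laplacian.
Context (g : R * R -> R) (g1 g2 : 'I_2 -> R * R -> R).
Hypotheses (gL : L2 g) (d1 : forall j, is_wderiv j g (g1 j)).
Hypothesis d2 : forall j, is_wderiv j (g1 j) (g2 j).

Let g1L j : L2 (g1 j) := (d1 j).1.
Let g2L j : L2 (g2 j) := (d2 j).1.

Let lapE : (fun x => - \sum_j g2 j x) =
  (fun x => -1 * (g2 ord0 x + g2 (lift ord0 ord0) x)).
Proof. by apply/funext => x; rewrite mulN1r sum_ord2. Qed.

Lemma fcos_laplacian k :
  fcos (fun x => - \sum_j g2 j x) k = wavenum_norm R k ^+ 2 * fcos g k.
Proof.
have c j : fcos (g2 j) k = - phase k (dir R j) ^+ 2 * fcos g k.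
  rewrite (fcos_wderiv k (g1L j) (d2 j)) (fsin_wderiv k gL (d1 j)).
  by move: (phase _ _) (fcos _ _) => a b; ring.
rewrite lapE (fcosZ _ k (torus_L2D (g2L _) (g2L _))) (fcosD k (g2L _) (g2L _)) !c.
rewrite wavenum_normE sum_ord2.
by move: (phase _ _) (phase _ _) (fcos _ _) => a b e; ring.
Qed.

Lemma fsin_laplacian k :
  fsin (fun x => - \sum_j g2 j x) k = wavenum_norm R k ^+ 2 * fsin g k.
Proof.
have c j : fsin (g2 j) k = - phase k (dir R j) ^+ 2 * fsin g k.
  rewrite (fsin_wderiv k (g1L j) (d2 j)) (fcos_wderiv k gL (d1 j)).
  by move: (phase _ _) (fsin _ _) => a b; ring.
rewrite lapE (fsinZ _ k (torus_L2D (g2L _) (g2L _))) (fsinD k (g2L _) (g2L _)) !c.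
rewrite wavenum_normE sum_ord2.
by move: (phase _ _) (phase _ _) (fsin _ _) => a b e; ring.
Qed.

Lemma fproj_laplacian m : fproj m (fun x => - \sum_j g2 j x) =
  (fun x => - \sum_j partial j (partial j (fproj m g)) x).
Proof.
have pp j : partial j (partial j (fproj m g)) = fproj m (g2 j).
  by rewrite (partial_fproj m gL (d1 j)) (partial_fproj m (g1L j) (d2 j)).
rewrite lapE (fprojZ m _ (torus_L2D (g2L _) (g2L _))) (fprojD m (g2L _) (g2L _)).
by apply/funext => x; rewrite mulN1r sum_ord2 !pp.
Qed.

End Laplacian.

Section Domain.
Context (u : vfield R) (hu : domA u).

Lemma domA_H : spaceH u. Proof. by case: hu => -[]. Qed.

Lemma domA_L2 : vL2 u. Proof. by have [] := domA_H. Qed.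

Lemma domA_wderiv i j : is_wderiv j (u i) (wderiv j (u i)).
Proof. by case: hu => [[_ /(_ i)[_ d]] _]; apply: wderivP; exact: d. Qed.

Lemma domA_wderiv2 i j :
  is_wderiv j (wderiv j (u i)) (wderiv j (wderiv j (u i))).
Proof. by case: hu => [_ /(_ i)[_ /(_ j)[_ d]]]; apply: wderivP; exact: d. Qed.

Lemma domA_wderiv_L2 i j : L2 (wderiv j (u i)).
Proof. by case: (domA_wderiv i j). Qed.

Lemma domA_wderiv2_L2 i j : L2 (wderiv j (wderiv j (u i))).
Proof. by case: (domA_wderiv2 i j). Qed.

Lemma opA_L2 : vL2 (opA u).
Proof.
by move=> i; apply: torus_L2N; apply: torus_L2_sum => j; exact: domA_wderiv2_L2.
Qed.

Lemma fcos_opA i k : fcos (opA u i) k = wavenum_norm R k ^+ 2 * fcos (u i) k.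
Proof.
exact: (@fcos_laplacian (u i) (fun j => wderiv j (u i))
  (fun j => wderiv j (wderiv j (u i))) (domA_L2 i) (domA_wderiv i) (domA_wderiv2 i) k).
Qed.

Lemma fsin_opA i k : fsin (opA u i) k = wavenum_norm R k ^+ 2 * fsin (u i) k.
Proof.
exact: (@fsin_laplacian (u i) (fun j => wderiv j (u i))
  (fun j => wderiv j (wderiv j (u i))) (domA_L2 i) (domA_wderiv i) (domA_wderiv2 i) k).
Qed.

(** The weak gradient [dphi] is left free: it is the chosen one when phi = u and the classical one
    when phi is trigonometric. *)
Lemma vdot_opA phi (dphi : 'I_2 -> 'I_2 -> R * R -> R) : vL2 phi ->
  (forall i j, is_wderiv j (phi i) (dphi i j)) ->
  vdot (opA u) phi =
  \sum_i \sum_j \int[torus]_x (wderiv j (u i) x * dphi i j x).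
Proof.
move=> pL dp; apply: eq_bigr => i _.
have dL := domA_wderiv2_L2 i.
transitivity (\int[torus]_x \sum_j - (wderiv j (wderiv j (u i)) x * phi i x)).
  by apply: eq_Rint => x; rewrite /opA mulNr mulr_suml sumrN.
rewrite Rint_sum; last by move=> j; apply: itgN; exact: torus_L2M.
apply: eq_bigr => j _; rewrite RintN; last exact: torus_L2M.
by rewrite (Rint_wderivC (domA_wderiv_L2 i j) (domA_wderiv2 i j) (pL i) (dp i j)).
Qed.

End Domain.

Lemma vdot_opA_self u : domA u -> vdot (opA u) u = normV u ^+ 2.
Proof.
move=> hu; rewrite (vdot_opA hu (domA_L2 hu) (domA_wderiv hu)) normV_sqr.
by apply: eq_bigr => i _; apply: eq_bigr => j _; apply: eq_Rint => x; rewrite expr2.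
Qed.

Lemma fproj0_mean_free g : \int[torus]_x g x = 0 -> fproj 0 g = fun=> 0.
Proof.
move=> g0; rewrite fprojE; apply/funext => x; rewrite big_seq big1// => k.
rewrite mem_modes => k0; have -> : k = 0.
  by apply/eqP; apply: contraTT k0 => /(wavenum_norm_ge1 R); rewrite -ltNge; lra.
rewrite /fcos /fsin.
rewrite (_ : \int[torus]_x _ = 0); last first.
  by rewrite -[RHS]g0; apply: eq_Rint => y; rewrite phase0 cos0 mulr1.
by rewrite phase0 sin0 !mulr0 mul0r addr0.
Qed.

(** Poincaré's inequality with constant 1, the smallest nonzero wavenumber for the period 2 pi;
    mean-free fields have no mode 0. *)
Lemma norm2_le_normV u : domA u -> norm2 u <= normV u.
Proof.
move=> hu; rewrite ler_wsqrtr// vdot_sqr.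
have [_ mf _] := domA_H hu.
apply: ler_sum => i _.
have cP k : 0 < wavenum_norm R k -> 1 <= wavenum_norm R k.
  move=> k0; apply: wavenum_norm_ge1; apply: contraTneq k0 => ->.
  by rewrite wavenum_norm0 ltxx.
apply: le_trans (Poincare_high_modes ler01 cP (domA_L2 hu i) (domA_wderiv hu i)).
rewrite expr1n mul1r fproj0_mean_free; last exact: mf.
by rewrite le_eqVlt; apply/orP; left; apply/eqP; apply: eq_Rint => x; rewrite subr0.
Qed.

(** ||u||^2 = (Au, u) <= |Au| |u| <= |Au| ||u||. *)
Lemma normV_le_norm2_opA u : domA u -> normV u <= norm2 (opA u).
Proof.
move=> hu; have [V0|V0] := ltP 0 (normV u); last exact: le_trans V0 (sqrtr_ge0 _).
rewrite -(ler_pM2r V0) -expr2 -vdot_opA_self//.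
apply: le_trans (ler_norm _) _.
apply: le_trans (vdot_CauchySchwarz (opA_L2 hu) (domA_L2 hu)) _.
by rewrite ler_wpM2l ?sqrtr_ge0// norm2_le_normV.
Qed.

Lemma norm2_gt0 u : vL2 u -> ~ veq u (fun _ _ => 0) -> 0 < norm2 u.
Proof.
move=> uL u0; rewrite lt_neqAle eq_sym sqrtr_ge0 andbT; apply/eqP => n0; apply: u0.
have : vdot u u = 0 by rewrite -norm2_sqr n0 expr0n.
rewrite vdot_sqr => /eqP; rewrite psumr_eq0; last by move=> i _; exact: Rint_sqr_ge0.
move=> /allP h i; have ui0 : \int[torus]_x u i x ^+ 2 = 0.
  by apply/eqP; apply: h; rewrite mem_index_enum.
by apply: filterS (torus_Rint_sqr_eq0 (uL i) ui0) => x.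
Qed.

(** * The test field A P_m u *)

Section TestField.
Context (u : vfield R) (hu : domA u) (m : R) (m_ge0 : 0 <= m).

(** P_m A u is a trigonometric polynomial at every point, whereas A P_m u is built from chosen weak
    derivatives and is known only up to a null set. *)
Definition trunc_opA : vfield R := fun i => fproj m (opA u i).

Lemma trigpoly_trunc_opA i : trigpoly (trunc_opA i).
Proof. exact: trigpoly_fproj. Qed.

Lemma trunc_opA_L2 : vL2 trunc_opA.
Proof. by move=> i; exact: L2_fproj. Qed.

Lemma trunc_opA_ae : veq (opA (opP m u)) trunc_opA.
Proof.
move=> i.
have E : trunc_opA i = fun x => - \sum_j partial j (partial j (fproj m (u i))) x.
  exact: (@fproj_laplacian (u i) (fun j => wderiv j (u i))
    (fun j => wderiv j (wderiv j (u i))) (domA_L2 hu i) (domA_wderiv hu i) (domA_wderiv2 hu i) m).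
have d j := wderiv2_trigpoly j (trigpoly_fproj m (u i)).
apply: filterS2 (d ord0) (d (lift ord0 ord0)) => x h0 h1.
rewrite E /opA => _; congr (- _).
rewrite (sum_ord2 (fun j => wderiv j (wderiv j (opP m u i)) x)).
by rewrite (sum_ord2 (fun j => partial j (partial j (fproj m (u i))) x)) h0 h1.
Qed.

Lemma opA_opP_L2 : vL2 (opA (opP m u)).
Proof.
move=> i; apply: torus_L2N; apply: torus_L2_sum => j.
have t := trigpoly_fproj m (u i); have t1 := trigpoly_partial j t.
have w1 : is_wderiv j (opP m u i) (wderiv j (opP m u i)).
  by apply: wderivP; exists (partial j (fproj m (u i))); exact: is_wderiv_trigpoly.
have : is_wderiv j (wderiv j (opP m u i)) (wderiv j (wderiv j (opP m u i))).
  apply: wderivP; exists (partial j (partial j (fproj m (u i)))).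
  apply: is_wderiv_ae (is_wderiv_trigpoly j t1); [exact: trigpoly_L2|exact: w1.1|].
  by apply: filterS (wderiv_trigpoly j t) => x ->.
by case.
Qed.

Lemma norm2_opA_opP : norm2 (opA (opP m u)) = norm2 trunc_opA.
Proof.
congr Num.sqrt; have aL := opA_opP_L2; have tL := trunc_opA_L2.
rewrite (eq_vdotl aL tL aL trunc_opA_ae) vdotC.
exact: (eq_vdotl aL tL tL trunc_opA_ae).
Qed.

Lemma fcos_trunc_opA i k : fcos (trunc_opA i) k =
  if wavenum_norm R k <= m then wavenum_norm R k ^+ 2 * fcos (u i) k else 0.
Proof. by rewrite fcos_fproj ?fcos_opA//; exact: opA_L2. Qed.

(** Testing with the cosine and the sine of mode k gives the imaginary and the real part of k .
    uhat_k = 0. *)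
Lemma div_free_Fourier k :
  \sum_i phase k (dir R i) * fcos (u i) k = 0 /\
  \sum_i phase k (dir R i) * fsin (u i) k = 0.
Proof.
have [uL _ du] := domA_H hu.
have tc := trigpoly_cos R k; have ts := trigpoly_sin R k.
have hs : \sum_i \int[torus]_x (u i x * partial i (fun x => cos (phase k x)) x) =
    - (2 * pi) ^+ 2 * \sum_i phase k (dir R i) * fsin (u i) k.
  rewrite mulr_sumr; apply: eq_bigr => i _; rewrite partial_cos.
  transitivity (- phase k (dir R i) * \int[torus]_x (u i x * sin (phase k x))).
    rewrite -RintZ; last exact: torus_L2M (uL i) (trigpoly_L2 ts).
    by apply: eq_Rint => x; ring.
  by rewrite Rint_sin; ring.
have hc : \sum_i \int[torus]_x (u i x * partial i (fun x => sin (phase k x)) x) =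
    (2 * pi) ^+ 2 * \sum_i phase k (dir R i) * fcos (u i) k.
  rewrite mulr_sumr; apply: eq_bigr => i _; rewrite partial_sin.
  transitivity (phase k (dir R i) * \int[torus]_x (u i x * cos (phase k x))).
    rewrite -RintZ; last exact: torus_L2M (uL i) (trigpoly_L2 tc).
    by apply: eq_Rint => x; ring.
  by rewrite Rint_cos; ring.
rewrite (du _ (trigpoly_smooth tc) (trigpoly_periodic tc)) in hs.
rewrite (du _ (trigpoly_smooth ts) (trigpoly_periodic ts)) in hc.
split.
  by apply: (mulfI (area_neq0 R)); rewrite mulr0.
apply: (mulfI (area_neq0 R)); rewrite mulr0.
by apply/eqP; rewrite -oppr_eq0 -mulNr -hs.
Qed.

(** The multiplier |k|^2 kills the mean and, being scalar, preserves k . uhat_k = 0. *)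
Lemma spaceH_trunc_opA : spaceH trunc_opA.
Proof.
split; first exact: trunc_opA_L2.
- move=> i; transitivity (\int[torus]_x (trunc_opA i x * cos (phase 0 x))).
    by apply: eq_Rint => x; rewrite phase0 cos0 mulr1.
  by rewrite Rint_cos fcos_trunc_opA wavenum_norm0 expr0n/= mul0r if_same mulr0.
- move=> psi spsi ppsi.
  have psiL := smooth_L2 spsi.
  have dL i := trigpoly_L2 (trigpoly_partial i (trigpoly_trunc_opA i)).
  transitivity (- \sum_i \int[torus]_x (partial i (trunc_opA i) x * psi x)).
    rewrite -sumrN; apply: eq_bigr => i _.
    exact: Rint_parts (trigpoly_trunc_opA i) spsi ppsi.
  rewrite -Rint_sum; last by move=> i; exact: torus_L2M.
  have -> : \int[torus]_x (\sum_i partial i (trunc_opA i) x * psi x) =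
      \int[torus]_x (0 : R); last by rewrite Rintegral_cst// mul0r oppr0.
  apply: eq_Rint => x; rewrite -mulr_suml.
  under eq_bigr do rewrite partial_fprojE.
  rewrite exchange_big/= big1 ?mul0r// => k _.
  have [dc ds] := div_free_Fourier k.
  transitivity (wavenum_norm R k ^+ 2 * (cos (phase k x) * (\sum_i phase k (dir R i) * fsin (u i) k) -
    sin (phase k x) * (\sum_i phase k (dir R i) * fcos (u i) k))).
    rewrite !mulr_sumr -sumrB mulr_sumr; apply: eq_bigr => i _.
    by rewrite (fcos_opA hu) (fsin_opA hu); ring.
  by rewrite dc ds !mulr0 subr0 mulr0.
Qed.

Lemma vdot_opA_trunc : vdot (opA u) trunc_opA = norm2 trunc_opA ^+ 2.
Proof.
rewrite norm2_sqr vdot_sqr; apply: eq_bigr => i _.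
by rewrite Rint_fproj_self//; exact: opA_L2.
Qed.

Lemma dirichlet_trunc_opA :
  Num.sqrt (dirichlet (fun i j => partial j (trunc_opA i))) <= m * norm2 trunc_opA.
Proof.
rewrite -[m]ger0_norm// -sqrtr_sqr -sqrtrM ?sqr_ge0// ler_wsqrtr// vdot_sqr mulr_sumr.
apply: ler_sum => i _.
have tL := trunc_opA_L2 i; have tt := trigpoly_trunc_opA i.
have := @grad_fproj_le R m _ _ m_ge0 tL (fun j => is_wderiv_trigpoly j tt).
(* The field and its partials equal their own truncations, so Bernstein's inequality bounds the full
   gradient. *)
rewrite (fproj_idem m (opA_L2 hu i)); apply: le_trans.
rewrite le_eqVlt; apply/orP; left; apply/eqP; apply: eq_bigr => j _.
apply: eq_Rint => x; rewrite -(partial_fproj m tL (is_wderiv_trigpoly j tt)).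
by rewrite (fproj_idem m (opA_L2 hu i)).
Qed.

End TestField.
End Estimates.

(** * Interpolation and convection estimates *)

Section Interpolation.
Context (R : realType).
Local Notation torus := (torus R).
Local Notation mR := (measurableTypeR R).
Implicit Types (u v w phi : vfield R) (cL cBG : R).

Definition sqnorm u (x : R * R) : R := \sum_i u i x ^+ 2.

Lemma sqnorm_ge0 u x : 0 <= sqnorm u x.
Proof. by apply: sumr_ge0 => i _; exact: sqr_ge0. Qed.

Lemma sqnorm_measurable u : vL2 u -> measurable_fun setT (sqnorm u : mR * mR -> R).
Proof.
move=> uL; apply: measurable_sum => i; apply: measurable_funX.
exact: torus_L2_measurable.
Qed.

Lemma sqnorm_itg u : vL2 u -> itg torus (sqnorm u).
Proof. by move=> uL; apply: itg_sum => i; case/torus_L2P: (uL i). Qed.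

Lemma Rint_sqnorm u : vL2 u -> \int[torus]_x sqnorm u x = norm2 u ^+ 2.
Proof.
move=> uL; rewrite norm2_sqr vdot_sqr Rint_sum// => i.
by case/torus_L2P: (uL i).
Qed.

Lemma sqnorm_outer u v x : \sum_i \sum_j (u j x * v i x) ^+ 2 = sqnorm u x * sqnorm v x.
Proof.
rewrite mulrC big_distrlr/=; apply: eq_bigr => i _; apply: eq_bigr => j _.
by rewrite exprMn mulrC.
Qed.

(** The inequality lives in the extended reals with a finite right side, so it already contains the
    integrability of |w|^4. The squared L^4 norm is then the square root of that integral. *)
Lemma ladyzhenskaya_sqnorm cL w : ladyzhenskaya cL -> spaceV w ->
  itg torus (fun x => sqnorm w x ^+ 2) /\
  Num.sqrt (\int[torus]_x sqnorm w x ^+ 2) <= cL * normV w * norm2 w.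
Proof.
move=> hL hw; have := hL w hw; have [[wL _ _] _] := hw.
rewrite /normLp unlock.
have E x : (`|(EFin \o vabs w) x| `^ 4)%E = (sqnorm w x ^+ 2)%:E.
  rewrite /= ger0_norm ?sqrtr_ge0// powR_mulrn ?sqrtr_ge0//.
  by rewrite (exprM _ 2 2) sqr_sqrtr// sqnorm_ge0.
under eq_integral do rewrite E.
set I := (\int[torus]_x _)%E => Ic.
have I0 : (0 <= I)%E by apply: integral_ge0 => x _; rewrite lee_fin sqr_ge0.
have Iy : (I < +oo)%E.
  rewrite ltey; apply/eqP => Iy; move: Ic; rewrite Iy poweRyr ?invr_neq0//.
have ms : measurable_fun setT (fun x : mR * mR => sqnorm w x ^+ 2).
  by apply: measurable_funX; exact: sqnorm_measurable.
split.
  apply/integrableP; split; first exact/measurable_EFinP.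
  rewrite (_ : (\int[torus]_x _)%E = I)//; apply: eq_integral => x _.
  by rewrite /= ger0_norm// sqr_ge0.
rewrite /Rintegral -/I; move: Ic.
rewrite -{1}(fineK (x := I)) ?ge0_fin_numE// poweR_EFin -EFin_expe lee_fin.
have i0 : 0 <= fine I by exact: fine_ge0.
set y := _ `^ _ => yc.
have y0 : 0 <= y by exact: powR_ge0.
have -> : fine I = (y ^+ 2) ^+ 2.
  by rewrite -exprM -powR_mulrn// /y -powRrM mulVf// powRr1.
by rewrite sqrtr_sqr ger0_norm// sqr_ge0.
Qed.

Lemma brezis_gallouet_vabs cBG v : brezis_gallouet cBG -> domA v ->
  \forall x \ae torus,
    vabs v x <= cBG * normV v * Num.sqrt (1 + ln (norm2 (opA v) / normV v)).
Proof.
move=> hB hv; have := hB v hv; rewrite /normLp unlock.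
(* The norm of exponent [+oo] is an essential supremum only on a space of positive measure. *)
have -> : (0 < torus setT)%E by rewrite torusT lte_fin exprn_gt0// mulr_gt0// pi_gt0.
move=> /ess_supP; apply: filterS => x.
by rewrite /= lee_fin ger0_norm// sqrtr_ge0.
Qed.

Lemma sqnorm_vabs u x : sqnorm u x = vabs u x ^+ 2.
Proof. by rewrite sqr_sqrtr// sqnorm_ge0. Qed.

Lemma abs_le_vabs u i x : `|u i x| <= vabs u x.
Proof.
rewrite -sqrtr_sqr ler_wsqrtr// (bigD1 i)//= lerDl.
by apply: sumr_ge0 => j _; exact: sqr_ge0.
Qed.

(** The gradient is set apart from the other two factors, the shape that [matrix_CauchySchwarz]
    expects. *)
Lemma vdot_advect a b phi :
  (forall i j, itg torus (fun x => wderiv j (b i) x * (a j x * phi i x))) ->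
  vdot (advect a b) phi =
  \sum_i \sum_j \int[torus]_x (wderiv j (b i) x * (a j x * phi i x)).
Proof.
move=> H; apply: eq_bigr => i _; rewrite -Rint_sum//.
apply: eq_Rint => x; rewrite mulr_suml; apply: eq_bigr => j _.
by rewrite [RHS]mulrCA mulrA.
Qed.

End Interpolation.

(** * Bounds on the convective and viscous terms *)

Section Convection.
Context (R : realType) (v w : vfield R) (hv : domA v) (hw : domA w).
Local Notation torus := (torus R).

(** The matrix of the w_i w_j has squared Frobenius norm |w|^4, so Cauchy-Schwarz leaves ||v|| times
    the squared L^4 norm of w. *)
Lemma convection_energy (cL : R) : ladyzhenskaya cL ->
  `|vdot (advect w v) w| <= cL * normV v * normV w * norm2 w.
Proof.
move=> hL; have [i4 l4] := ladyzhenskaya_sqnorm hL hw.1.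
have wL := domA_L2 hw.
have wwL i j : L2 (fun x => w j x * w i x).
  apply/torus_L2P; split.
    by apply: measurable_funM; exact: torus_L2_measurable.
  apply: (le_itg _ i4).
    by apply: measurable_funX; apply: measurable_funM; exact: torus_L2_measurable.
  apply: nearW => x; rewrite ger0_norm ?sqr_ge0// [leRHS]expr2 -sqnorm_outer.
  rewrite (bigD1 i)//= (bigD1 j)//= -addrA lerDl addr_ge0//.
    by apply: sumr_ge0 => ? _; exact: sqr_ge0.
  by apply: sumr_ge0 => ? _; apply: sumr_ge0 => ? _; exact: sqr_ge0.
have dL := domA_wderiv_L2 hv.
rewrite vdot_advect; last by move=> i j; exact: torus_L2M (dL i j) (wwL i j).
have := @matrix_CauchySchwarz R (fun i j => wderiv j (v i))
  (fun i j x => w j x * w i x) _ dL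
  (fun i j => torus_L2M (dL i j) (wwL i j)) i4.
have bnd : \forall x \ae torus, \sum_i \sum_j (w j x * w i x) ^+ 2 <= sqnorm w x ^+ 2.
  by apply: nearW => x; rewrite sqnorm_outer expr2.
move=> /(_ bnd) /le_trans; apply; rewrite -normVE.
apply: le_trans (ler_wpM2l (sqrtr_ge0 _) l4) _.
by rewrite !mulrA [normV v * cL]mulrC.
Qed.

Section BoundedField.
Context (M : R) (M_ge0 : 0 <= M) (vM : \forall x \ae torus, vabs v x <= M).

Lemma sqnorm_bounded : \forall x \ae torus, sqnorm v x <= M ^+ 2.
Proof.
apply: filterS vM => x vxM.
by rewrite sqnorm_vabs lerXn2r// nnegrE sqrtr_ge0.
Qed.

Lemma component_bounded j : \forall x \ae torus, `|v j x| <= M.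
Proof. by apply: filterS vM => x; apply: le_trans; exact: abs_le_vabs. Qed.

Lemma bounded_mul_L2 j g : L2 g -> L2 (fun x => v j x * g x).
Proof.
move=> gL; exact: (@L2_mul_bounded _ _ _ torus M _ _
  (torus_L2_measurable (domA_L2 hv j)) gL (component_bounded j)).
Qed.

Lemma sqrt_scaled_sqnorm (u : vfield R) : vL2 u ->
  Num.sqrt (\int[torus]_x (M ^+ 2 * sqnorm u x)) = M * norm2 u.
Proof.
move=> uL; rewrite RintZ; last exact: sqnorm_itg.
by rewrite Rint_sqnorm// -exprMn sqrtr_sqr ger0_norm// mulr_ge0// sqrtr_ge0.
Qed.

Lemma convection_antisym : vdot (advect v w) w = 0.
Proof.
have wL := domA_L2 hw; have dL := domA_wderiv_L2 hw.
have [vL _ vdiv] := domA_H hv.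
rewrite vdot_advect; last by move=> i j; exact: torus_L2M (dL i j) (bounded_mul_L2 j (wL i)).
rewrite big1// => i _.
rewrite -[RHS](div_free_antisym vL vdiv component_bounded (wL i) (domA_wderiv hw i)).
apply: eq_bigr => j _; apply: eq_Rint => x.
by rewrite mulrCA mulrA.
Qed.

Lemma convection_by_bounded phi : vL2 phi ->
  `|vdot (advect v w) phi| <= M * normV w * norm2 phi.
Proof.
move=> pL; have dL := domA_wderiv_L2 hw.
have vpL i j := bounded_mul_L2 j (pL i).
rewrite vdot_advect; last by move=> i j; exact: torus_L2M (dL i j) (vpL i j).
have := @matrix_CauchySchwarz R (fun i j => wderiv j (w i))
  (fun i j x => v j x * phi i x) (fun x => M ^+ 2 * sqnorm phi x) dL
  (fun i j => torus_L2M (dL i j) (vpL i j)) (itgZ _ (sqnorm_itg pL)).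
have bnd : \forall x \ae torus,
    \sum_i \sum_j (v j x * phi i x) ^+ 2 <= M ^+ 2 * sqnorm phi x.
  apply: filterS sqnorm_bounded => x vxM.
  by rewrite sqnorm_outer ler_wpM2r// sqnorm_ge0.
move=> /(_ bnd) /le_trans; apply; rewrite -normVE sqrt_scaled_sqnorm//.
by rewrite mulrCA mulrA.
Qed.

(** The derivative falls on v, of which only the size is to be used; since w is divergence-free, it
    can be moved onto phi. *)
Lemma convection_of_bounded (phi : vfield R) : (forall i, trigpoly (phi i)) ->
  `|vdot (advect w v) phi| <=
  M * norm2 w * Num.sqrt (dirichlet (fun i j => partial j (phi i))).
Proof.
move=> tp; have [wL _ wdiv] := domA_H hw; have dL := domA_wderiv_L2 hv.
have vL := domA_L2 hv.
have tdL i j : L2 (partial j (phi i)) by exact/trigpoly_L2/trigpoly_partial.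
have wpL i j := L2_mul_trigpoly (wL j) (tp i).
have vwL i j := bounded_mul_L2 i (wL j).
have -> : vdot (advect w v) phi =
    - \sum_i \sum_j \int[torus]_x (partial j (phi i) x * (v i x * w j x)).
  rewrite vdot_advect; last by move=> i j; exact: torus_L2M (dL i j) (wpL i j).
  rewrite -sumrN; apply: eq_bigr => i _.
  have := div_free_skew wL wdiv (vL i) (domA_wderiv hv i) (tp i).
  have -> : \sum_j \int[torus]_x (w j x * wderiv j (v i) x * phi i x) =
      \sum_j \int[torus]_x (wderiv j (v i) x * (w j x * phi i x)).
    by apply: eq_bigr => j _; apply: eq_Rint => x; rewrite [RHS]mulrCA mulrA.
  move=> ->; congr (- _); apply: eq_bigr => j _; apply: eq_Rint => x.
  by rewrite [RHS]mulrC [v i x * _]mulrC.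
rewrite normrN.
have := @matrix_CauchySchwarz R (fun i j => partial j (phi i))
  (fun i j x => v i x * w j x) (fun x => M ^+ 2 * sqnorm w x) tdL
  (fun i j => torus_L2M (tdL i j) (vwL i j)) (itgZ _ (sqnorm_itg wL)).
have bnd : \forall x \ae torus,
    \sum_i \sum_j (v i x * w j x) ^+ 2 <= M ^+ 2 * sqnorm w x.
  apply: filterS sqnorm_bounded => x vxM.
  by rewrite exchange_big/= sqnorm_outer ler_wpM2r// sqnorm_ge0.
move=> /(_ bnd) /le_trans; apply; rewrite sqrt_scaled_sqnorm//.
by rewrite mulrC.
Qed.

End BoundedField.

Lemma vdot_opA_le (phi : vfield R) : (forall i, trigpoly (phi i)) ->
  `|vdot (opA w) phi| <=
  normV w * Num.sqrt (dirichlet (fun i j => partial j (phi i))).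
Proof.
move=> tp; have dL := domA_wderiv_L2 hw.
have tdL i j : L2 (partial j (phi i)) by exact/trigpoly_L2/trigpoly_partial.
have td2 i j : itg torus (fun x => partial j (phi i) x ^+ 2).
  by case/torus_L2P: (tdL i j).
rewrite (vdot_opA hw (fun i => trigpoly_L2 (tp i))
  (fun i j => is_wderiv_trigpoly j (tp i))).
have := @matrix_CauchySchwarz R (fun i j => wderiv j (w i))
  (fun i j => partial j (phi i)) (fun x => \sum_i \sum_j partial j (phi i) x ^+ 2) dL
  (fun i j => torus_L2M (dL i j) (tdL i j)).
have si : itg torus (fun x => \sum_i \sum_j partial j (phi i) x ^+ 2).
  by apply: itg_sum => i; exact: itg_sum.
have bnd : \forall x \ae torus,
    \sum_i \sum_j partial j (phi i) x ^+ 2 <= \sum_i \sum_j partial j (phi i) x ^+ 2.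
  exact: nearW.
move=> /(_ si bnd) /le_trans; apply; rewrite -normVE.
have -> // : \int[torus]_x (\sum_i \sum_j partial j (phi i) x ^+ 2) =
    dirichlet (fun i j => partial j (phi i)).
rewrite Rint_sum; last by move=> i; exact: itg_sum.
by apply: eq_bigr => i _; rewrite Rint_sum.
Qed.

End Convection.

(** * The sensitivity bound *)

Lemma test_identity_bound (R : realFieldType)
    (nu mu y1 y2 y3 y4 y5 X A B C D : R) : 0 <= nu -> 0 <= mu ->
  nu * y1 + mu * y2 + (y3 + y4) = - y5 -> y5 = X ->
  - y1 <= A -> - y2 <= B -> - y3 <= C -> - y4 <= D ->
  X <= nu * A + mu * B + C + D.
Proof.
move=> nu0 mu0 E <- y1A y2B y3C y4D.
have := ler_wpM2l nu0 y1A; have := ler_wpM2l mu0 y2B; lra.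
Qed.

Section Sensitivity.
Context (R : realType).
Local Notation torus := (torus R).
Implicit Types (u v w phi : vfield R).

Lemma opP_L2 (m : R) u : vL2 (opP m u).
Proof. by move=> i; exact: L2_fproj. Qed.

(** The equation for w enters the proof in this form only, with phi = w and with phi the truncation
    of A v. *)
Lemma sensitivity_weak (nu mu m : R) v w : domA v -> domA w ->
  (exists2 b, is_DB v w b &
    veq (fun i x => nu * opA w i x + mu * opP m w i x + b i x)
        (fun i x => - opA v i x)) ->
  forall phi, spaceH phi ->
  nu * vdot (opA w) phi + mu * vdot (opP m w) phi +
    (vdot (advect v w) phi + vdot (advect w v) phi) = - vdot (opA v) phi.
Proof.
move=> hv hw [b [b1 [b2 [B1 B2 ->]]] eqn] phi hphi.
have [pL _ _] := hphi.
have b1L : vL2 b1 by case: B1 => _ [].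
have b2L : vL2 b2 by case: B2 => _ [].
have AwL := opA_L2 hw; have AvL := opA_L2 hv; have PL := opP_L2 m w.
have nL : vL2 (fun i x => nu * opA w i x) by move=> i; exact: torus_L2Z.
have mL : vL2 (fun i x => mu * opP m w i x) by move=> i; exact: torus_L2Z.
have nmL : vL2 (fun i x => nu * opA w i x + mu * opP m w i x).
  by move=> i; exact: torus_L2D (nL i) (mL i).
have bL : vL2 (fun i x => b1 i x + b2 i x).
  by move=> i; exact: torus_L2D (b1L i) (b2L i).
have NvL : vL2 (fun i x => - opA v i x) by move=> i; exact: torus_L2N (AvL i).
have totL : vL2 (fun i x => nu * opA w i x + mu * opP m w i x + (b1 i x + b2 i x)).
  by move=> i; exact: torus_L2D (nmL i) (bL i).
rewrite -(vdot_leray B1 hphi) -(vdot_leray B2 hphi).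
rewrite -(vdotZl nu AwL pL) -(vdotZl mu PL pL) -(vdotNl AvL pL).
rewrite -(vdotDl nL mL pL) -(vdotDl b1L b2L pL) -(vdotDl nmL bL pL).
exact: eq_vdotl totL NvL pL eqn.
Qed.

Lemma vdot_opP_self (m : R) u : vL2 u -> vdot (opP m u) u = norm2 (opP m u) ^+ 2.
Proof.
move=> uL; rewrite norm2_sqr vdot_sqr vdotC; apply: eq_bigr => i _.
by rewrite Rint_fproj_self.
Qed.

Lemma low_modes_defect (N : nat) u : domA u ->
  N%:R ^+ 2 * (norm2 u ^+ 2 - norm2 (opP N%:R u) ^+ 2) <= normV u ^+ 2.
Proof.
move=> hu; have uL := domA_L2 hu.
rewrite !norm2_sqr !vdot_sqr -sumrB mulr_sumr normV_sqr.
apply: ler_sum => i _; rewrite -Rint_sqr_fproj_compl//.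
have hk k : N%:R < wavenum_norm R k -> N%:R <= wavenum_norm R k by exact: ltW.
exact: (Poincare_high_modes (ler0n R N) hk (uL i) (domA_wderiv hu i)).
Qed.

(** From |v| <= ||v||, the logarithm of |Av| / ||v|| is at most that of |Av| / |v|; from ||v|| <=
    |Av| it is nonnegative, so the square root squares back. The quadratic bound serves the
    condition on mu, the linear one that on N. *)
Lemma brezis_gallouet_bound (cBG : R) v : brezis_gallouet cBG -> domA v ->
  ~ veq v (fun _ _ => 0) ->
  exists M, [/\ 0 <= M, \forall x \ae torus, vabs v x <= M,
    M ^+ 2 <= cBG ^+ 2 * normV v ^+ 2 * (1 + ln (norm2 (opA v) / norm2 v)) &
    M <= Num.max 0 (cBG * normV v * Num.sqrt (1 + ln (norm2 (opA v) / norm2 v)))].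
Proof.
move=> hB hv v0; have n0 := norm2_gt0 (domA_L2 hv) v0.
have nV := norm2_le_normV hv; have VA := normV_le_norm2_opA hv.
have V0 : 0 < normV v := lt_le_trans n0 nV.
have A0 : 0 < norm2 (opA v) := lt_le_trans V0 VA.
have vM := brezis_gallouet_vabs hB hv.
move: (normV v) (norm2 v) (norm2 (opA v)) nV VA V0 n0 A0 vM => V n a nV VA V0 n0 A0.
set L' := 1 + ln (a / V); set L := 1 + ln (a / n) => vM.
have L'0 : 0 <= L'.
  by rewrite addr_ge0// ln_ge0// ler_pdivlMr// mul1r.
have L'L : L' <= L.
  rewrite lerD2l ler_ln ?posrE ?divr_gt0//.
  by rewrite ler_wpM2l ?(ltW A0)// lef_pV2 ?posrE.
(* The sign of [cBG] is not assumed; the maximum makes M nonnegative. *)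
exists (Num.max 0 (cBG * V * Num.sqrt L')); split.
- by rewrite le_max lexx.
- apply: filterS vM => x vx.
  by apply: le_trans vx _; rewrite le_max lexx orbT.
- apply: (@le_trans _ _ ((cBG * V * Num.sqrt L') ^+ 2)).
    have [h|h] := leP 0 (cBG * V * Num.sqrt L'); first by rewrite lexx.
    by rewrite expr0n sqr_ge0.
  by rewrite !exprMn sqr_sqrtr// ler_wpM2l// mulr_ge0// sqr_ge0.
- have [c0|c0] := leP 0 cBG.
    have h : cBG * V * Num.sqrt L' <= cBG * V * Num.sqrt L.
      by rewrite ler_wpM2l ?ler_wsqrtr// mulr_ge0// ltW.
    by rewrite ge_max !le_max lexx h orbT.
  have h : cBG * V * Num.sqrt L' <= 0.
    by apply: mulr_le0_ge0; rewrite ?sqrtr_ge0//; apply: mulr_le0_ge0; exact: ltW.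
  by rewrite ge_max !le_max lexx h.
Qed.

End Sensitivity.

Theorem corollary4p6 (R : realType) (cL cBG : R)
    (hL : ladyzhenskaya cL) (hBG : brezis_gallouet cBG)
    (nu nuh mu : R) (nu_gt0 : 0 < nu) (nuh_gt0 : 0 < nuh) (mu_gt0 : 0 < mu)
    (N : nat)
    (f : vfield R) (hf : spaceH f)
    (u : vfield R) (hu : domA u)
    (u_eq : exists2 b, is_B u u b &
      veq (fun i x => nu * opA u i x + b i x) f)
    (v : vfield R) (hv : domA v) (v_neq0 : ~ veq v (fun _ _ => 0))
    (v_eq : exists2 b, is_B v v b &
      veq (fun i x => nuh * opA v i x + b i x + mu * opP N%:R v i x)
          (fun i x => f i x + mu * opP N%:R u i x))
    (w : vfield R) (hw : domA w)
    (w_eq : exists2 b, is_DB v w b &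
      veq (fun i x => nuh * opA w i x + mu * opP N%:R w i x + b i x)
          (fun i x => - opA v i x))
    (hmu : Num.max (32 * cL ^+ 2 * normV v ^+ 2 / nuh)
             (16 * cBG ^+ 2 * normV v ^+ 2 / nuh
                * (1 + ln (norm2 (opA v) / norm2 v))) <= mu)
    (hN : Num.max (8 * cL * normV v / nuh)
            (4 * cBG * normV v / nuh
               * Num.sqrt (1 + ln (norm2 (opA v) / norm2 v))) <= N%:R) :
  1 / 3 * sup [set norm2 (opA (opP m v)) ^+ 2 / (nuh * m ^+ 2 + mu)
                | m in [set m : R | 0 < m <= N%:R]]
    <= - vdot (opA v) w.
Proof.
have n0 := norm2_gt0 (domA_L2 hv) v_neq0.
have V0 : 0 < normV v := lt_le_trans n0 (norm2_le_normV hv).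
have [M [M0 vM M2 M1]] := brezis_gallouet_bound hBG hv v_neq0.
have weak := sensitivity_weak hv hw w_eq.
have wH := domA_H hw; have wL := domA_L2 hw.
set W := normV w; set p := norm2 (opP N%:R w); set n := norm2 w.
set c := cL * normV v.
have W0 : 0 <= W := sqrtr_ge0 _.
have p0 : 0 <= p := sqrtr_ge0 _.
have nn0 : 0 <= n := sqrtr_ge0 _.
have energy : nuh * W ^+ 2 + mu * p ^+ 2 - c * W * n <= - vdot (opA v) w.
  rewrite -(weak _ wH) (vdot_opA_self hw) (vdot_opP_self N%:R wL).
  rewrite (convection_antisym hv hw vM) add0r lerD2l.
  by have := convection_energy hv hw hL; rewrite ler_norml => /andP[].
move: hmu hN; rewrite !ge_max => /andP[mu1 mu2] /andP[N1 N2].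
have c1 : 8 * c <= nuh * N%:R.
  have -> : 8 * c = 8 * cL * normV v by rewrite /c mulrA.
  by rewrite [nuh * _]mulrC -ler_pdivrMr.
have c2 : 32 * c ^+ 2 <= mu * nuh.
  have -> : 32 * c ^+ 2 = 32 * cL ^+ 2 * normV v ^+ 2 by rewrite /c exprMn mulrA.
  by rewrite -ler_pdivrMr.
have M2' : 16 * M ^+ 2 <= mu * nuh.
  apply: le_trans (ler_wpM2l _ M2) _; first by [].
  by move: mu2; rewrite mulrAC ler_pdivrMr// !mulrA.
have M1' : 4 * M <= nuh * N%:R.
  have nN0 : 0 <= nuh * N%:R by rewrite mulr_ge0// ltW.
  apply: le_trans (ler_wpM2l _ M1) _; first by [].
  rewrite maxr_pMr// mulr0 ge_max nN0/=.
  by move: N2; rewrite mulrAC ler_pdivrMr// [N%:R * _]mulrC !mulrA.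
(* For N = 0 no m qualifies and the supremum of the empty set is 0 by convention. The condition on N
   then forces c <= 0, and the energy bound makes the right side nonnegative. *)
have [N0|N0] := posnP N.
  rewrite (_ : [set _ | _ in _] = set0) ?sup0 ?mulr0.
    apply: le_trans energy.
    have c0 : c <= 0 by move: c1; rewrite N0 mulr0; lra.
    have h1 : c * W * n <= 0 by rewrite -mulrA mulr_le0_ge0// mulr_ge0.
    have h2 : 0 <= nuh * W ^+ 2 by rewrite mulr_ge0 ?sqr_ge0// ltW.
    have h3 : 0 <= mu * p ^+ 2 by rewrite mulr_ge0 ?sqr_ge0// ltW.
    lra.
  apply/seteqP; split=> // _ [m /= + _]; rewrite N0 => /andP[m0 m1].
  by move: (lt_le_trans m0 m1); rewrite ltxx.
have NR0 : 0 < N%:R :> R by rewrite ltr0n.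
have key m : 0 < m <= N%:R ->
    norm2 (opA (opP m v)) ^+ 2 / (nuh * m ^+ 2 + mu) <= 3 * - vdot (opA v) w.
  move=> /andP[m0 mN].
  rewrite norm2_opA_opP//; set phi := trunc_opA v m; set X := norm2 phi.
  have X0 : 0 <= X := sqrtr_ge0 _.
  have tp := trigpoly_trunc_opA v m.
  have dphi := dirichlet_trunc_opA hv (ltW m0).
  have phiL := trunc_opA_L2 v m.
  apply: (sensitivity_algebra nuh_gt0 mu_gt0 m0 NR0 W0 p0 nn0 X0 M0 M2' M1' c1 c2 mN
    (low_modes_defect N hw) energy).
  have test := weak _ (spaceH_trunc_opA hv m).
  have e1 : - vdot (opA w) phi <= W * (m * X).
    apply: le_trans (ler_norm _) _; rewrite normrN.
    apply: le_trans (vdot_opA_le hw tp) _.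
    by rewrite ler_wpM2l.
  have e2 : - vdot (opP N%:R w) phi <= p * X.
    apply: le_trans (ler_norm _) _; rewrite normrN.
    exact: vdot_CauchySchwarz (opP_L2 _ _) phiL.
  have e3 : - vdot (advect v w) phi <= M * W * X.
    apply: le_trans (ler_norm _) _; rewrite normrN.
    exact: convection_by_bounded.
  have e4 : - vdot (advect w v) phi <= M * n * (m * X).
    apply: le_trans (ler_norm _) _; rewrite normrN.
    apply: le_trans (convection_of_bounded hv hw M0 vM tp) _.
    by rewrite ler_wpM2l// mulr_ge0.
  exact: (test_identity_bound (ltW nuh_gt0) (ltW mu_gt0) test
    (vdot_opA_trunc hv m) e1 e2 e3 e4).
have : sup [set norm2 (opA (opP m v)) ^+ 2 / (nuh * m ^+ 2 + mu)
    | m in [set m : R | 0 < m <= N%:R]] <= 3 * - vdot (opA v) w.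
  (* An upper bound dominates the supremum of a nonempty set; m = N is a member. *)
  apply: ge_sup; last by move=> _ [m /= mN <-]; exact: key.
  exists (norm2 (opA (opP N%:R v)) ^+ 2 / (nuh * N%:R ^+ 2 + mu)).
  by exists N%:R => //=; rewrite NR0 lexx.
by move=> supP; rewrite div1r mulrC ler_pdivrMr// [_ * 3]mulrC.
Qed.
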